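(* Let $X$ be a Banach space with an unconditional basis. Then either $X$ has a quasi-minimal subspace, or $X$ has a block subspace $Y$ such that no two disjointly supported block subspaces of $Y$ are isomorphic (and hence any two disjointly supported block subspaces of $Y$ are totally incomparable).
   Context: Banach spaces and subspaces are infinite-dimensional; subspaces are closed; isomorphic means linearly homeomorphic. Supports are taken with respect to the given unconditional basis $(e_n)$ of $X$; $x<y$ means $\max\operatorname{supp}(x)<\min\operatorname{supp}(y)$. A block subspace is the closed linear span of an infinite sequence $x_1<x_2<\cdots$ of nonzero vectors (a block basis); a block subspace of $Y$ is a subspace of $Y$ generated by a block basis consisting of vectors of $Y$. Two block subspaces $V,W$ are disjointly supported if the support of every $v\in V$ is disjoint from the support of every $w\in W$. Two spaces $V$ and $W$ are totally incomparable if no infinite-dimensional subspace of $V$ is isomorphic to a subspace of $W$. A space is quasi-minimal if it does not contain a pair of totally incomparable (infinite-dimensional) subspaces. *)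

(* Defs.v *)
From HB Require Import structures.
From mathcomp Require Import all_boot all_order all_algebra.
From mathcomp Require Import complex.
From mathcomp Require Import all_classical all_reals all_analysis.

Set Implicit Arguments.
Unset Strict Implicit.
Unset Printing Implicit Defensive.

Import Order.TTheory GRing.Theory Num.Theory.
Import numFieldNormedType.Exports.

Local Open Scope classical_set_scope.
Local Open Scope ring_scope.

(* All spaces under consideration are subspaces of one ambient Banach space X,
   so they are represented by sets of vectors of X. *)

Section Subspaces.
Context {K : numFieldType} {X : completeNormedModType K}.
Implicit Types (V W Q : set X) (x : nat -> X).

Definition closed_subspace V : Prop :=
  GRing.submod_closed (mem V) /\ closed V.

Definition finite_dimensional V : Prop :=
  exists n (v : 'I_n -> X),
    V = [set u | exists c : 'I_n -> K, u = \sum_(i < n) c i *: v i].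

Definition inf_dim_subspace V : Prop :=
  closed_subspace V /\ ~ finite_dimensional V.

Definition closed_span x : set X :=
  closure [set u | exists n (c : nat -> K), u = \sum_(i < n) c i *: x i].

Definition linear_on V (T : X -> X) : Prop :=
  forall (a : K) u v, V u -> V v -> T (a *: u + v) = a *: T u + T v.

(* T and S are only relevant on V and W respectively; their values elsewhere
   are unconstrained. *)
Definition isomorphic V W : Prop :=
  exists T S : X -> X,
    [/\ set_fun V W T /\ set_fun W V S,
        {in V, cancel T S} /\ {in W, cancel S T},
        linear_on V T,
        {within V, continuous T} &
        {within W, continuous S}].

Definition totally_incomparable V W : Prop :=
  ~ exists V' W',
      [/\ inf_dim_subspace V', V' `<=` V,
          closed_subspace W', W' `<=` W &
          isomorphic V' W'].

Definition quasi_minimal Q : Prop :=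
  ~ exists V W,
      [/\ inf_dim_subspace V /\ V `<=` Q,
          inf_dim_subspace W /\ W `<=` Q &
          totally_incomparable V W].

End Subspaces.

Section Bases.
Context {K : numFieldType} {X : completeNormedModType K}.
Variable e : nat -> X.
Implicit Types (u v : X) (x : nat -> X) (V W Y : set X).

Definition expansion u (a : nat -> K) : Prop :=
  series (fun n => a n *: e n) @ \oo --> u.

Definition schauder_basis : Prop :=
  forall u, exists! a : nat -> K, expansion u a.

(* Every expansion converges unconditionally, i.e. all its rearrangements
   converge. *)
Definition unconditional_basis : Prop :=
  schauder_basis /\
  forall u (a : nat -> K), expansion u a ->
    forall s : nat -> nat, bijective s ->
      cvgn (series (fun n => a (s n) *: e (s n))).

(* Only meaningful when e is a Schauder basis. *)
Definition coord u : nat -> K := xget (fun=> 0) [set a | expansion u a].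

Definition supp u : set nat := [set n | coord u n != 0].

(* For nonzero u and v this says max supp u < min supp v; in particular it
   forces supp u to be finite. *)
Definition supp_lt u v : Prop :=
  forall i j, supp u i -> supp v j -> (i < j)%N.

Definition block_basis x : Prop :=
  (forall n, x n != 0) /\ (forall n, supp_lt (x n) (x n.+1)).

Definition block_subspace_of Y V : Prop :=
  exists x, [/\ block_basis x, forall n, Y (x n) & V = closed_span x].

Definition block_subspace V : Prop := block_subspace_of [set: X] V.

Definition disjointly_supported V W : Prop :=
  forall v w, V v -> W w -> supp v `&` supp w = set0.

End Bases.

(* Main.v *)
Require Import Defs.
From HB Require Import structures.
From mathcomp Require Import all_boot all_order all_algebra.
From mathcomp Require Import complex.
From mathcomp Require Import all_classical all_reals all_analysis.
From mathcomp Require Import ring lra.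

(**
A pair of isomorphic subspaces of disjointly supported block subspaces yields, by
choosing vectors that vanish on longer and longer initial segments together
with their images, disjointly supported block sequences [x] and [y] that are
[C]-equivalent.  If for every [Y] and [C] some block subspace of [Y] has no
such pair, diagonalizing over [C] gives the second alternative.

Otherwise, for some [Y] and [C], every block subspace of [Y] contains such a
pair, and a Gowers-type game gives a quasi-minimal subspace.  A play is an
infinite word giving the coordinates of [x] and [y], rounded to finite grids,
so that there are finitely many positions of each length and fusion arguments
need no approximation.  Diagonalization gives [Z] such that for each position
either no subspace of [Z] contains a good continuation, or every subspace of
[Z] does (the position is live).  From a live position, one can answer any two
block subspaces [U], [V] of [Z] with pieces of [x] taken from [U] and pieces of
[y] from [V] so that a whole pair [x k, y k] gets completed at a live position:
otherwise a further fusion produces a subspace without good continuation.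
Iterating, arbitrary [U] and [V] contain equivalent sequences.
*)

Set Implicit Arguments.
Unset Strict Implicit.
Unset Printing Implicit Defensive.

Import Order.TTheory GRing.Theory Num.Theory.
Import numFieldNormedType.Exports.

Local Open Scope classical_set_scope.
Local Open Scope ring_scope.

(** * Block sequences and fusion *)

(** One word can carry both sequences because [x k] and [y k] lie in the span of one block sequence
    and have disjoint supports: on each block at most one of them is nonzero, and one bit tells
    which. The grids can be fixed before any fusion, since the projections of the basis are
    uniformly bounded and so are the coordinates of bounded vectors. The constant [C] must be fixed
    throughout the game. For fixed [C], goodness is a closed condition: equivalence of the first [n]
    pairs depends on finitely many letters, so a limit of live positions is good. With varying
    constants this would fail, which is why the negation has to be diagonalized over [C]. Rounding
    destroys homogeneous inequalities, hence equivalence is stated with an additive slack and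
    coefficients of modulus at most 1, together with a lower bound on combinations having a
    coefficient of modulus 1. That lower bound is 4 for the original pairs, 3 after rounding, 2
    after replacing the grid values by the vectors actually played, and 1 after moving from blocks
    into arbitrary subspaces. The final 1 absorbs the slack and gives a genuine isomorphism. *)

Definition fspan {K : fieldType} {X : lmodType K} (w : nat -> X) (x : X) : Prop :=
  exists n (a : nat -> K), x = \sum_(i < n) a i *: w i.

Section FiniteSpan.
Context {K : fieldType} {X : lmodType K}.
Implicit Types (w : nat -> X) (x y : X).

Lemma fspan_pad w n (a : nat -> K) m : (n <= m)%N ->
  \sum_(i < n) a i *: w i = \sum_(i < m) (if (i < n)%N then a i else 0) *: w i.
Proof.
move=> nm; rewrite (big_ord_widen m (fun i => a i *: w i) nm) big_mkcond /=.
by apply: eq_bigr => i _; case: ifP => // _; rewrite scale0r.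
Qed.

Lemma fspan_lin w (k : K) x y : fspan w x -> fspan w y -> fspan w (k *: x + y).
Proof.
move=> [n [a ->]] [m [b ->]]; exists (maxn n m).
exists (fun i => k * (if (i < n)%N then a i else 0) + (if (i < m)%N then b i else 0)).
rewrite (fspan_pad _ _ (leq_maxl n m)) (fspan_pad _ _ (leq_maxr n m)).
rewrite scaler_sumr -big_split /=; apply: eq_bigr => i _.
by rewrite scalerDl scalerA.
Qed.

Lemma fspan0 w : fspan w 0.
Proof. by exists 0%N, (fun=> 0); rewrite big_ord0. Qed.

Lemma fspanZ w (k : K) x : fspan w x -> fspan w (k *: x).
Proof. by move=> wx; rewrite -[_ *: _]addr0; apply: fspan_lin => //; exact: fspan0. Qed.

Lemma fspanD w x y : fspan w x -> fspan w y -> fspan w (x + y).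
Proof. by move=> wx wy; rewrite -[x]scale1r; exact: fspan_lin. Qed.

Lemma fspan_sum w (I : Type) (r : seq I) (P : pred I) (F : I -> X) :
  (forall i, P i -> fspan w (F i)) -> fspan w (\sum_(i <- r | P i) F i).
Proof.
move=> h; elim/big_ind: _ => //; first exact: fspan0.
by move=> x y; exact: fspanD.
Qed.

Lemma fspan_gen w i : fspan w (w i).
Proof.
exists i.+1, (fun j => if j == i then 1 else 0).
rewrite big_ord_recr /= eqxx scale1r big1 ?add0r // => j _.
by rewrite ltn_eqF // scale0r.
Qed.

Lemma fspan_trans w w' x : (forall i, fspan w (w' i)) -> fspan w' x -> fspan w x.
Proof. by move=> h [n [a ->]]; apply: fspan_sum => i _; exact: fspanZ. Qed.

End FiniteSpan.

(* The cuts delimit the supports; they are part of the data because plays of the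
   game below may only stop at cuts. *)
Record blocks {K : fieldType} {X : lmodType K} (c : nat -> X -> K) := Blocks {
  vec :> nat -> X;
  cut : nat -> nat;
  cut_lt : forall n, (cut n < cut n.+1)%N;
  vec_neq0 : forall n, exists i, c i (vec n) != 0;
  vec_supp : forall n i, ~~ (cut n <= i < cut n.+1)%N -> c i (vec n) = 0
}.

Section Blocks.
Context {K : fieldType} {X : lmodType K} (c : nat -> X -> K).
Hypothesis c_lin : forall i (k : K) u v, c i (k *: u + v) = k * c i u + c i v.
Implicit Types (B U V W Z : blocks c) (x : X).

Lemma coef0 i : c i 0 = 0.
Proof. by have := c_lin i (-1) 0 0; rewrite scaler0 addr0 mulN1r addNr. Qed.

Lemma coefZ i k u : c i (k *: u) = k * c i u.
Proof. by rewrite -[k *: u]addr0 c_lin coef0 addr0. Qed.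

Lemma coefD i u v : c i (u + v) = c i u + c i v.
Proof. by rewrite -[u]scale1r c_lin mul1r scale1r. Qed.

Lemma coef_sum i (I : Type) (r : seq I) (P : pred I) (F : I -> X) :
  c i (\sum_(j <- r | P j) F j) = \sum_(j <- r | P j) c i (F j).
Proof. by elim/big_rec2: _ => [|j y1 y2 _ <-]; [exact: coef0|exact: coefD]. Qed.

Lemma cut_mono B : {mono cut B : m n / (m <= n)%N}.
Proof. by apply: leq_mono; apply: homo_ltn => [??? |]; [exact: ltn_trans|exact: cut_lt]. Qed.

Lemma cut_monolt B : {mono cut B : m n / (m < n)%N}.
Proof. exact: leqW_mono (cut_mono B). Qed.

Lemma cut_ge B n : (n <= cut B n)%N.
Proof. by elim: n => // n ih; exact: leq_ltn_trans ih (cut_lt B n). Qed.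

Lemma cut_find B i : (cut B 0 <= i)%N -> exists j, (cut B j <= i < cut B j.+1)%N.
Proof.
move=> i0; pose P j := (i < cut B j)%N.
have exP : exists j, P j by exists i.+1; exact: leq_trans (cut_ge B i.+1).
case: (ex_minnP exP) => -[|j]; rewrite /P; first by rewrite ltnNge i0.
move=> ij mn; exists j; rewrite ij andbT leqNgt; apply/negP => /mn.
by rewrite ltnn.
Qed.

Lemma cut_uniq B i j l : (cut B j <= i < cut B j.+1)%N -> (cut B l <= i < cut B l.+1)%N -> j = l.
Proof.
move=> /andP[a b] /andP[a' b'].
have : (j < l.+1)%N by rewrite -(cut_monolt B) (leq_ltn_trans a).
have : (l < j.+1)%N by rewrite -(cut_monolt B) (leq_ltn_trans a').
by rewrite !ltnS => jl lj; apply/eqP; rewrite eqn_leq jl lj.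
Qed.

Lemma vec_other B i j l : (cut B j <= i < cut B j.+1)%N -> l != j -> c i (B l) = 0.
Proof.
move=> ij lj; apply: vec_supp; apply/negP => il.
by move/eqP: lj; apply; exact: cut_uniq il ij.
Qed.

Lemma vec_pivot B n : exists2 i, (cut B n <= i < cut B n.+1)%N & c i (B n) != 0.
Proof.
have [i ni] := vec_neq0 B n; exists i => //.
by apply: contraNT ni => /vec_supp ->.
Qed.

Lemma coef_comb B n (a : nat -> K) i j : (cut B j <= i < cut B j.+1)%N ->
  c i (\sum_(l < n) a l *: B l) = (if (j < n)%N then a j else 0) * c i (B j).
Proof.
move=> ij; rewrite coef_sum.
under eq_bigr => l _ do rewrite coefZ.
case: ltnP => jn; last first.
  rewrite mul0r big1 // => l _; rewrite (vec_other ij) ?mulr0 //.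
  by rewrite ltn_eqF // (leq_trans (ltn_ord l)).
rewrite (bigD1 (Ordinal jn)) //= big1 ?addr0 // => l lj.
by rewrite (vec_other ij) ?mulr0.
Qed.

Lemma coef_comb0 B n (a : nat -> K) i : (i < cut B 0)%N ->
  c i (\sum_(l < n) a l *: B l) = 0.
Proof.
move=> i0; rewrite coef_sum big1 // => l _; rewrite coefZ vec_supp ?mulr0 //.
by rewrite leqNgt (leq_trans i0) // cut_mono.
Qed.

Lemma coef_fspan0 B x i : fspan B x -> (i < cut B 0)%N -> c i x = 0.
Proof. by move=> [n [a ->]] i0; rewrite coef_comb0. Qed.

(** A position of the game on [B] is a word of length [cut B 0]; keeping the first cut makes it a
    position on [B'] as well. Taking the other cuts of [B'] among those of [B] lets runs on [B'] be
    read on [B]. *)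
Definition sub B' B : Prop :=
  [/\ cut B' 0 = cut B 0, forall n, fspan B (B' n) &
      forall n, exists m, cut B' n = cut B m].

Lemma sub_refl B : sub B B.
Proof. by split=> // n; [exact: fspan_gen|exists n]. Qed.

Lemma sub_trans B2 B1 B3 : sub B1 B2 -> sub B2 B3 -> sub B1 B3.
Proof.
move=> [a1 b1 c1] [a2 b2 c2]; split; first by rewrite a1.
  by move=> n; apply: (fspan_trans b2).
by move=> n; have [m ->] := c1 n; exact: c2.
Qed.

Definition tail k B : blocks c :=
  @Blocks K X c (fun n => B (n + k)%N) (fun n => cut B (n + k)%N)
    (fun n => cut_lt B (n + k)) (fun n => vec_neq0 B (n + k))
    (fun n i => @vec_supp K X c B (n + k) i).

(** The coefficient of an early block is read off at a pivot coordinate of that block, where [x]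
    vanishes. *)
Lemma fspan_tail k B x : fspan B x -> (forall i, (i < cut B k)%N -> c i x = 0) ->
  fspan (tail k B) x.
Proof.
move=> [n [a ->]] h; apply: fspan_sum => j _.
case: (ltnP j k) => jk; last by apply: fspanZ; rewrite -(subnK jk); exact: (fspan_gen (tail k B)).
have [i ij ci] := vec_pivot B j.
have := h i; rewrite (coef_comb _ _ ij) ltn_ord => hz.
suff -> : a j = 0 by rewrite scale0r; exact: fspan0.
have /eqP : a j * c i (B j) = 0.
  by apply: hz; rewrite (leq_trans (proj2 (andP ij))) // cut_mono.
by rewrite mulf_eq0 (negPf ci) orbF => /eqP.
Qed.

Lemma sub_tail B' B j' j : sub B' B -> cut B' j' = cut B j -> sub (tail j' B') (tail j B).
Proof.
move=> [h1 h2 h3] e; split => //= n.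
  apply: fspan_tail; first exact: h2.
  move=> i ij; apply: vec_supp; rewrite leqNgt (leq_trans ij) //.
  by rewrite -e cut_mono leq_addl.
have [m em] := h3 (n + j')%N; exists (m - j)%N; rewrite em subnK //.
by rewrite -(cut_mono B) -em -e cut_mono leq_addl.
Qed.

Lemma sub_tailD k l B : sub (tail (l + k) B) (tail l (tail k B)).
Proof.
split=> //= n; last by exists n => /=; rewrite addnA.
by rewrite addnA; exact: (fspan_gen (tail l (tail k B)) n).
Qed.

Lemma sub_tail0 B : sub (tail 0 B) B.
Proof.
split=> //= n; first by rewrite addn0; exact: fspan_gen.
by exists n; rewrite addn0.
Qed.

Lemma sub_tail0r B : sub B (tail 0 B).
Proof.
split=> // n; last by exists n; rewrite /= addn0.
by have := fspan_gen (tail 0 B) n; rewrite /= addn0.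
Qed.

(** Diagonal argument: [C n.+1] refines the first tail of [C n], and [W] collects the first blocks.
    As [sub] keeps first cuts, these blocks are adjacent, and the [n]-th tail of [W] refines [C n],
    hence inherits [Req n]. [Inv] is what the density hypothesis may rely on. *)
Lemma fusion (Inv : blocks c -> Prop) (Req : nat -> blocks c -> Prop) :
  (forall B B', sub B' B -> Inv B -> Inv B') ->
  (forall B, Inv B -> Inv (tail 1 B)) ->
  (forall n B B', sub B' B -> Req n B -> Req n B') ->
  (forall n B, Inv B -> exists2 B', sub B' B & Req n B') ->
  forall B, Inv B -> exists2 W, sub W B & forall n, Req n (tail n W).
Proof.
move=> Inv_sub Inv_tail Req_sub Req_dense B IB.
have /choice[f fP] : forall nC : nat * blocks c, exists C', Inv nC.2 ->
    sub C' nC.2 /\ Req nC.1 C'.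
  move=> [n C] /=; have [IC|nIC] := pselect (Inv C); last by exists C.
  by have [C' ? ?] := Req_dense n C IC; exists C'.
pose fix C n := if n is m.+1 then f (n, tail 1 (C m)) else f (0%N, B).
have IC n : Inv (C n).
  elim: n => [|n ih] /=.
    by have [s _] := fP (0%N, B) IB; exact: Inv_sub s IB.
  have It := Inv_tail _ ih.
  by have [s _] := fP (n.+1, _) It; exact: Inv_sub s It.
have C0 : sub (C 0%N) B by have [] := fP (0%N, B) IB.
have CS n : sub (C n.+1) (tail 1 (C n)).
  by have [] := fP (n.+1, tail 1 (C n)) (Inv_tail _ (IC n)).
have CR n : Req n (C n).
  case: n => [|n] /=; first by have [] := fP (0%N, B) IB.
  by have [] := fP (n.+1, tail 1 (C n)) (Inv_tail _ (IC n)).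
have cutC n : cut (C n.+1) 0 = cut (C n) 1 by have [] := CS n.
pose W := @Blocks K X c (fun n => C n 0%N) (fun n => cut (C n) 0).
have Wlt n : (cut (C n) 0 < cut (C n.+1) 0)%N by rewrite cutC cut_lt.
have Wnz n := vec_neq0 (C n) 0.
have Wsup n i : ~~ (cut (C n) 0 <= i < cut (C n.+1) 0)%N -> c i (C n 0%N) = 0.
  by rewrite cutC; exact: vec_supp.
have fsC d n j : fspan (C n) (C (d + n)%N j).
  elim: d j => [|d ih] j; first exact: fspan_gen.
  rewrite addSn; have [_ h _] := CS (d + n)%N.
  by apply: fspan_trans (h j) => i; exact: ih.
have ctC d n j : exists m, cut (C (d + n)%N) j = cut (C n) m.
  elim: d j => [|d ih] j; first by exists j.
  by rewrite addSn; have [_ _ h] := CS (d + n)%N; have [m ->] := h j; exact: ih.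
pose W' := W Wlt Wnz Wsup.
have tW n : sub (tail n W') (C n).
  split=> [|k|k]; [by []|exact: fsC|exact: ctC].
exists W'; last by move=> n; exact: Req_sub (tW n) (CR n).
apply: sub_trans C0; apply: sub_trans (tW 0%N); exact: sub_tail0r.
Qed.

End Blocks.

(** * The game *)

Section Game.
Context {K : fieldType} {X : lmodType K} (c : nat -> X -> K).
Hypothesis c_lin : forall i (k : K) u v, c i (k *: u + v) = k * c i u + c i v.
Context (grid : nat -> seq K) (near : nat -> K -> K -> Prop).

(* [(g, b, f)]: a grid value for the current coordinate, whether this coordinate
   belongs to the second vector of the current pair, whether the pair ends here. *)
Definition letter : Type := (K * bool * bool)%type.

Context (good : (nat -> letter) -> Prop).
Hypothesis good_flags : forall a, good a -> forall m, exists2 i, (m <= i)%N & (a i).2.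

Implicit Types (B U V W Z : blocks c) (x y : X) (a : nat -> letter) (s : seq letter).

(** * Words over the grids and runs along a block sequence *)

Definition letters i : seq letter :=
  [seq (p, f) | p <- [seq (g, b) | g <- grid i, b <- [:: true; false]], f <- [:: true; false]].

Fixpoint words m : seq (seq letter) :=
  if m is m'.+1 then [seq rcons s l | s <- words m', l <- letters m'] else [:: [::]].

Lemma mem_letters i (l : letter) : (l \in letters i) = (l.1.1 \in grid i).
Proof.
apply/allpairsP/idP => [[[p f] [/allpairsP[[g b] [gm _ ->]] _ ->]] //|].
case: l => -[g b] f gi; have {}gi : g \in grid i := gi.
exists ((g, b), f); split; [|by case: f|by []].
by apply/allpairsP; exists (g, b); split; [|case: b|].
Qed.

Lemma mem_words a m :
  reflect (forall i, (i < m)%N -> (a i).1.1 \in grid i) (mkseq a m \in words m).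
Proof.
apply: (iffP idP).
  elim: m => // m ih; rewrite mkseqS => /allpairsP[[s l] [sm lm]].
  move=> /rcons_inj[e1 e2] i; rewrite ltnS leq_eqVlt => /orP[/eqP ->|]; last first.
    by apply: ih; rewrite e1.
  by rewrite -mem_letters e2.
elim: m => // m ih h; rewrite mkseqS; apply/allpairsP; exists (mkseq a m, a m); split => //.
  by apply: ih => i im; apply: h; exact: ltnW.
by rewrite mem_letters; exact: h.
Qed.

Lemma mkseq_eq a a' m : mkseq a m = mkseq a' m -> forall i, (i < m)%N -> a i = a' i.
Proof.
move=> e i im; have := congr1 (nth (0, false, false) ^~ i) e.
by rewrite !nth_mkseq.
Qed.

Lemma eq_mkseq_lt a a' m : (forall i, (i < m)%N -> a i = a' i) -> mkseq a m = mkseq a' m.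
Proof. by move=> h; apply/eq_in_map => i; rewrite mem_iota => /h. Qed.

(** A chunk belongs to a single side of the pair, and a pair can end only at its last coordinate, so
    that completed pairs always end at cuts. *)
Definition chunk x m m' b a : Prop := forall i, (m <= i < m')%N ->
  [/\ near i (c i x) (a i).1.1, (a i).1.1 \in grid i, (a i).1.2 = b & (a i).2 -> i.+1 = m'].

Definition run B a : Prop := forall j, exists (k : K) b,
  chunk (k *: B j) (cut B j) (cut B j.+1) b a.

(** A multiple of a block of [B'], restricted to a block of [B], is a multiple of the latter,
    possibly zero. An end of a pair falls on a cut of [B'], which is also a cut of [B]. *)
Lemma run_sub B' B a : sub B' B -> run B' a -> run B a.
Proof.
move=> [e0 h1 h2] r l.
have [j /andP[jl lj]] : exists j, (cut B' j <= cut B l < cut B' j.+1)%N.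
  by apply: cut_find; rewrite e0 cut_mono.
have [k [b hk]] := r j; have [n [d ed]] := h1 j.
exists (k * (if (l < n)%N then d l else 0)), b => i il.
have ll : (cut B l.+1 <= cut B' j.+1)%N.
  by move: lj; have [m ->] := h2 j.+1; rewrite cut_monolt cut_mono.
have /hk[hn hg hb hf] : (cut B' j <= i < cut B' j.+1)%N.
  by case/andP: il => i1 i2; rewrite (leq_trans jl i1) (leq_trans i2).
split => //.
  by move: hn; rewrite ed (coefZ c_lin) (coef_comb c_lin _ _ il) coefZ // mulrA.
move=> /hf ef; apply/eqP; rewrite eqn_leq (proj2 (andP il)) ef.
by move: ll; rewrite -ef.
Qed.

Definition avoids s B : Prop := ~ exists a, [/\ s = mkseq a (cut B 0), run B a & good a].

Definition live s B : Prop := forall B', sub B' B -> ~ avoids s B'.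

Lemma avoids_sub s B B' : sub B' B -> avoids s B -> avoids s B'.
Proof.
move=> sB nA [a [es ra ga]]; apply: nA; exists a; split => //; last exact: run_sub ra.
by case: sB => <-.
Qed.

Lemma live_sub s B B' : sub B' B -> live s B -> live s B'.
Proof. by move=> sB h B'' sB'; apply: h; exact: sub_trans sB' sB. Qed.

Lemma live_good s B : live s B -> exists2 a, s = mkseq a (cut B 0) & good a.
Proof.
move=> /(_ B (sub_refl B)) /contrapT[a [? _ ?]].
by exists a.
Qed.

(** * Replies and forced positions *)

Definition ended s : bool := (last (0, false, false) s).2.

Lemma ended_mkseq a m : ended (mkseq a m.+1) = (a m).2.
Proof. by rewrite /ended mkseqS last_rcons. Qed.

(** The reply stops at a cut of the offered [U], not merely of [B]. The new position therefore
    exists in every sequence lying between [U] and [B], as [forces_sub] requires. *)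
Definition reply U B s s' b j : Prop := exists a x l,
  [/\ (0 < l)%N, cut U l = cut B j, s = mkseq a (cut B 0), s' = mkseq a (cut B j) &
   [/\ fspan U x, (forall i, ~~ (cut B 0 <= i < cut B j)%N -> c i x = 0) &
       chunk x (cut B 0) (cut B j) b a]].

Lemma reply_sub U U' B' B s s' b j' : sub U' U -> sub B' B ->
  reply U' B' s s' b j' -> exists j, cut B j = cut B' j' /\ reply U B s s' b j.
Proof.
move=> [u1 u2 u3] [b1 b2 b3] [a [x [l [l0 e1 e2 e3 [f1 f2 f3]]]]].
have [j ej] := b3 j'; exists j; split => //.
have [l' el'] := u3 l; exists a, x, l'.
split; rewrite -?ej -?b1 -?el' //; last first.
  by split => //; exact: fspan_trans f1.
by rewrite -(cut_monolt U) -u1 -el' cut_monolt.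
Qed.

(* Two block sequences [U] and [V] are offered; a reply consists either of a piece
   of the first vector of the pair, taken from [U], or of a piece of the second
   one, taken from [V]. *)
Definition step (P : seq letter -> blocks c -> Prop) s B : Prop :=
  forall U V, sub U B -> sub V B -> exists b s' j,
    reply (if b then V else U) B s s' b j /\
    ((ended s' /\ live s' (tail j B)) \/ (~~ ended s' /\ P s' (tail j B))).

(* The least fixed point of [step]: finitely many replies complete a pair at a live
   position, whatever is offered. *)
Definition forces s B : Prop := forall P, (forall s B, step P s B -> P s B) -> P s B.

Lemma step_mono (P Q : seq letter -> blocks c -> Prop) s B :
  (forall s B, P s B -> Q s B) -> step P s B -> step Q s B.
Proof.
move=> PQ h U V sU sV; have [b [s' [j [r o]]]] := h U V sU sV.
by exists b, s', j; split => //; case: o => [?|[? ?]]; [left|right; split => //; exact: PQ].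
Qed.

Lemma forces_step s B : step forces s B -> forces s B.
Proof.
move=> h P hP; refine (hP _ _ _); apply: (@step_mono forces P s B _ h) => s' B' f; exact: f.
Qed.

Lemma reply_gt0 U B s s' b j : reply U B s s' b j -> cut U 0 = cut B 0 -> (0 < j)%N.
Proof.
move=> [a [x [l [l0 e1 e2 e3 _]]]] e; rewrite -(cut_monolt B) -e1 -e.
by rewrite cut_monolt.
Qed.

(** Induction on the fixed point: offers inside [B'] are offers inside [B], and the winning reply
    stops at a cut of the offer, hence at a cut of [B']. *)
Lemma forces_sub s B B' : sub B' B -> forces s B -> forces s B'.
Proof.
move=> sB fB.
apply: (fB (fun s B => forall B', sub B' B -> forces s B') _ B' sB) => {fB sB B'} {}s {}B h B' sB.
apply: forces_step => U V sU sV.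
have [b [s' [j [r o]]]] := h U V (sub_trans sU sB) (sub_trans sV sB).
have [j' ej] : exists j', cut B' j' = cut B j.
  case: r => a [x [l [_ <- _ _ _]]].
  have [_ _ h3] : sub (if b then V else U) B' by case: (b).
  by have [m ->] := h3 l; exists m.
have b0 : cut B' 0 = cut B 0 by case: sB.
have st := sub_tail c_lin sB ej.
exists b, s', j'; split; last first.
  case: o => -[e o]; [left|right]; split => //; first exact: live_sub o.
  exact: o.
case: r => a [x [l r]]; exists a, x, l; move: r.
by rewrite -ej -b0.
Qed.

(** * Deciding positions by fusion *)

Definition hopeless s B : Prop := forall B', sub B' B -> ~ forces s B'.

Lemma hopeless_sub s B B' : sub B' B -> hopeless s B -> hopeless s B'.
Proof. by move=> sB h B'' sB'; apply: h; exact: sub_trans sB' sB. Qed.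

Lemma dense_all (R : seq letter -> blocks c -> Prop) :
  (forall s B B', sub B' B -> R s B -> R s B') ->
  forall (l : seq (seq letter)) B,
  (forall s, s \in l -> forall B', sub B' B -> exists2 B'', sub B'' B' & R s B'') ->
  exists2 B', sub B' B & forall s, s \in l -> R s B'.
Proof.
move=> Rsub; elim=> [|s l ih] B h; first by exists B => //; exact: sub_refl.
have [B1 sB1 R1] := h s (mem_head _ _) B (sub_refl B).
have [|B2 sB2 R2] := ih B1.
  by move=> t tl B' sB'; apply: h; [rewrite inE tl orbT|exact: sub_trans sB' sB1].
exists B2; first exact: sub_trans sB2 sB1.
move=> t; rewrite inE => /orP[/eqP ->|]; last exact: R2.
exact: Rsub sB2 R1.
Qed.

Definition decided s B : Prop :=
  (avoids s B \/ live s B) /\ (forces s B \/ hopeless s B).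

Lemma decided_sub s B B' : sub B' B -> decided s B -> decided s B'.
Proof.
move=> sB [h1 h2]; split.
  by case: h1 => h; [left; exact: avoids_sub h|right; exact: live_sub h].
by case: h2 => h; [left; exact: forces_sub h|right; exact: hopeless_sub h].
Qed.

Lemma decided_dense s B : exists2 B', sub B' B & decided s B'.
Proof.
have [B1 sB1 d1] : exists2 B', sub B' B & avoids s B' \/ live s B'.
  have [h|h] := pselect (live s B); first by exists B; [exact: sub_refl|right].
  by move/existsNP: h => [B' /not_implyP[sB' /contrapT hB']]; exists B' => //; left.
have [B2 sB2 d2] : exists2 B', sub B' B1 & forces s B' \/ hopeless s B'.
  have [h|h] := pselect (hopeless s B1); first by exists B1; [exact: sub_refl|right].
  by move/existsNP: h => [B' /not_implyP[sB' /contrapT hB']]; exists B' => //; left.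
exists B2; first exact: sub_trans sB2 sB1.
split => //; case: d1 => h; [left; exact: avoids_sub h|right; exact: live_sub h].
Qed.

Definition stable Z : Prop :=
  forall n s, s \in words (cut Z n) -> decided s (tail n Z).

(** Only finitely many words over the grids have a given length, so the positions at one cut can be
    decided one after another, and fusion then treats all cuts. *)
Lemma stabilize Z0 : exists2 Z, sub Z Z0 & stable Z.
Proof.
have [||||Z sZ hZ] := @fusion K X c (fun=> True)
   (fun _ B => forall s, s \in words (cut B 0) -> decided s B) _ _ _ _ Z0 I => //.
- move=> n B B' sB h s; have [-> _ _] := sB => sw.
  exact: decided_sub sB (h s sw).
- move=> _ B _; have [||B' sB hB'] := @dense_all decided _ (words (cut B 0)) B.
  + exact: decided_sub.
  + by move=> s _ B' _; exact: decided_dense.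
  by exists B' => // s; have [-> _ _] := sB; exact: hB'.
- by exists Z => // n s; exact: hZ.
Qed.

Lemma stable_sub Z Z' : sub Z' Z -> stable Z -> stable Z'.
Proof.
move=> sZ h n s; have [_ _ /(_ n)[m em]] := sZ; rewrite em => sw.
by apply: decided_sub (h m s sw); apply: sub_tail.
Qed.

Lemma stable_tail k Z : stable Z -> stable (tail k Z).
Proof.
move=> h n s sw; apply: decided_sub (h (n + k)%N s sw).
split=> //= j; last by exists j; rewrite addnA.
by rewrite -addnA; exact: (fspan_gen (tail (n + k) Z) j).
Qed.

(** In a stable sequence this is exactly what failing the winning condition of [step] leaves over,
    since every position is either avoided or live, and either forced or hopeless. *)
Definition lost s B : Prop := (ended s -> avoids s B) /\ (~~ ended s -> hopeless s B).

Lemma lost_sub s B B' : sub B' B -> lost s B -> lost s B'.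
Proof.
move=> sB [h1 h2]; split=> [/h1|/h2]; [exact: avoids_sub|exact: hopeless_sub].
Qed.

Definition losing b s B : Prop := forall s' j, reply B B s s' b j -> lost s' (tail j B).

Lemma losing_sub b s B B' : sub B' B -> losing b s B -> losing b s B'.
Proof.
move=> sB h s' j' /(reply_sub sB sB)[j [ej r]].
by apply: lost_sub (h _ _ r); apply: sub_tail.
Qed.

Lemma reply_words U B s s' b j : s \in words (cut B 0) -> reply U B s s' b j ->
  s' \in words (cut B j).
Proof.
move=> sw [a [x [l [l0 e1 e2 e3 [_ _ ch]]]]]; rewrite e3; apply/mem_words => i ij.
case: (ltnP i (cut B 0)) => i0.
  by move: sw; rewrite e2 => /mem_words; exact.
by have /ch[] : (cut B 0 <= i < cut B j)%N by rewrite i0.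
Qed.

Lemma not_won_lost s' B j : stable B -> s' \in words (cut B j) ->
  ~ ((ended s' /\ live s' (tail j B)) \/ (~~ ended s' /\ forces s' (tail j B))) ->
  lost s' (tail j B).
Proof.
move=> sB sw nW; have [d1 d2] := sB j _ sw; split => e.
  by case: d1 => // l; exfalso; apply: nW; left.
by case: d2 => // f; exfalso; apply: nW; right.
Qed.

(** As [s] is not forced in any refinement, some offer [U], [V] has no winning reply. Passing to the
    offered sequence of side [b] makes all replies on that side lost. The sides are treated in turn,
    because the second refinement keeps the first conclusion. *)
Lemma losing_dense s B : stable B -> s \in words (cut B 0) -> hopeless s B ->
  exists2 B', sub B' B & losing true s B' /\ losing false s B'.
Proof.
move=> stB sw hB.
have half b C : sub C B -> exists2 C', sub C' C & losing b s C'.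
  move=> sC; have nf := hB _ sC; have stC := stable_sub sC stB.
  have {}nf : ~ step forces s C by move/forces_step.
  move/existsNP: nf => [U /existsNP[V /not_implyP[sU /not_implyP[sV]]]].
  move=> /forallNP/(_ b) /forallNP nf.
  have swC : s \in words (cut C 0) by case: sC => ->.
  exists (if b then V else U); first by case: (b).
  move=> s' j' /(@reply_sub _ (if b then V else U) _ C _ _ _ _ (sub_refl _)).
  have sUV : sub (if b then V else U) C by case: (b).
  move=> /(_ sUV)[j [ej r]].
  have := nf s' => /forallNP/(_ j) /not_andP[|nW]; first by case: (b) r.
  apply: lost_sub (not_won_lost stC (reply_words swC r) nW).
  by apply: sub_tail.
have [B1 sB1 l1] := half true B (sub_refl B).
have [B2 sB2 l2] := half false B1 sB1.
exists B2; first exact: sub_trans sB2 sB1.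
by split => //; exact: losing_sub l1.
Qed.

(* Otherwise a fusion yields [W] all of whose runs from [s] stay in lost positions,
   so that a good run in [W] can never complete a pair. *)
Lemma live_forces Z s : stable Z -> s \in words (cut Z 0) -> live s Z -> forces s Z.
Proof.
move=> stZ sw lv.
have [d1] := stZ 0%N s sw.
case=> [|hl]; first by apply: forces_sub; exact: sub_tail0r.
exfalso; have {}hl : hopeless s Z by apply: hopeless_sub hl; exact: sub_tail0r.
pose R s B := forces s B \/ (losing true s B /\ losing false s B).
have R_sub t B B' : sub B' B -> R t B -> R t B'.
  move=> sB [f|[l1 l2]]; first by left; exact: forces_sub f.
  by right; split; exact: losing_sub sB _.
have [||||W sW hW] := @fusion K X c stable
   (fun _ B => forall s, s \in words (cut B 0) -> R s B) _ _ _ _ Z stZ.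
- by move=> B B' sB; exact: stable_sub.
- by move=> B; exact: stable_tail.
- move=> n B B' sB h t; have [-> _ _] := sB => tw.
  exact: R_sub sB (h t tw).
- move=> _ B stB; have [||B' sB hB'] := @dense_all R _ (words (cut B 0)) B.
  + exact: R_sub.
  + move=> t tw B' sB'.
    have tw' : t \in words (cut B' 0) by case: sB' => ->.
    have stB' := stable_sub sB' stB.
    have [_ [f|h]] := stB' 0%N t tw'.
      exists B'; first exact: sub_refl.
      by left; apply: forces_sub f; exact: sub_tail0r.
    have [|B'' sB'' l] := @losing_dense t B' stB' tw'.
      by apply: hopeless_sub h; exact: sub_tail0r.
    by exists B'' => //; right.
  by exists B' => // t; have [-> _ _] := sB; exact: hB'.
have [a [es ra ga]] : exists a, [/\ s = mkseq a (cut W 0), run W a & good a].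
  by apply: contrapT; exact: lv sW.
have stW := stable_sub sW stZ.
have aw k : mkseq a (cut W k) \in words (cut W k).
  apply/mem_words => i ik; case: (ltnP i (cut W 0)) => i0.
    move: sw; rewrite es; have [<- _ _] := sW.
    by move=> /mem_words; exact.
  have [l il] := cut_find i0; have [k' [b ch]] := ra l.
  by have [] := ch i il.
have ra_tail k : run (tail k W) a by move=> j; exact: ra.
have navoid k : ~ avoids (mkseq a (cut W k)) (tail k W).
  by apply; exists a.
(* A single block of [W], with the multiple prescribed by the run, is a legal reply, so the run
   itself is subject to [losing]. *)
have lostS k : hopeless (mkseq a (cut W k)) (tail k W) ->
    lost (mkseq a (cut W k.+1)) (tail k.+1 W).
  move=> hk; have [f|[lt lf]] := hW k _ (aw k); first by have := hk _ (sub_refl _) f.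
  have [k' [b ch]] := ra k.
  have rp : reply (tail k W) (tail k W) (mkseq a (cut W k)) (mkseq a (cut W k.+1)) b 1.
    exists a, (k' *: W k), 1%N; split => //; split => //.
      by apply: fspanZ; exact: (fspan_gen (tail k W) 0%N).
    by move=> i ik; rewrite (coefZ c_lin) vec_supp ?mulr0.
  apply: lost_sub (sub_tailD k 1 W) _.
  by case: b {ch} rp; [exact: lt|exact: lf].
(* Had a pair just been completed, the lost position would be avoided, although the good run [a]
   passes through it; so the position stays hopeless. *)
have hlk k : hopeless (mkseq a (cut W k)) (tail k W).
  elim: k => [|k /lostS[l1 l2]].
    rewrite -es; apply: hopeless_sub hl.
    exact: sub_trans (sub_tail0 W) sW.
  by apply: l2; apply/negP => /l1; exact: navoid.
(* A good word nevertheless completes a pair after the starting position, and the same argument at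
   that cut is the contradiction. *)
have [i i0 fi] := good_flags ga (cut W 0).
have [k ik] := cut_find i0; have [k' [b ch]] := ra k.
have [_ _ _ /(_ fi) ei] := ch i ik.
have [l1 _] := lostS k (hlk k).
by apply: (navoid k.+1); apply: l1; rewrite -ei ended_mkseq.
Qed.

(** The two given subspaces must be offered again at every later position, where [sub] fails because
    of the first cut. Only the span from which replies are drawn matters. *)
Definition fits U B : Prop :=
  exists2 U', sub U' B & forall x, fspan U' x -> fspan U x.

Lemma fits_sub U B : sub U B -> fits U B.
Proof. by move=> sU; exists U. Qed.

Lemma fits_tail j U B : fits U B -> fits U (tail j B).
Proof.
move=> [U' [u0 u1 u2] UU'].
(* Since [cut U' n] is at least [n], dropping [cut B j] blocks leaves only blocks beyond [cut B j];
   the first cut is then lowered to that value. *)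
pose l := cut B j.
have cl n : (cut B j <= cut U' (n + l))%N.
  by apply: leq_trans (cut_ge U' (n + l)); exact: leq_addl.
pose ct n := if n is n'.+1 then cut U' (n + l) else cut B j.
have ct_lt n : (ct n < ct n.+1)%N.
  by case: n => [|n]; [exact: leq_ltn_trans (cl 0%N) (cut_lt U' (0 + l))|exact: cut_lt].
have v0 n := vec_neq0 U' (n + l).
have vs n i : ~~ (ct n <= i < ct n.+1)%N -> c i (U' (n + l)%N) = 0.
  move=> h; apply: vec_supp; apply: contra h => /andP[h1 h2].
  apply/andP; split; last by [].
  by case: n h1 {h2} => [|n]; [exact: leq_trans (cl 0%N)|].
exists (@Blocks K X c (fun n => U' (n + l)%N) ct ct_lt v0 vs); last first.
  move=> x fx; apply: UU'; apply: fspan_trans fx => i; exact: fspan_gen.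
split=> //= n; last first.
  case: n => [|n] /=; first by exists 0%N.
  have [m em] := u2 (n.+1 + l)%N; exists (m - j)%N.
  rewrite em subnK // -(cut_mono B) -em; exact: cl.
apply: (fspan_tail c_lin); first exact: u1.
move=> i ij; apply: vec_supp; rewrite leqNgt (leq_trans ij) //; exact: cl.
Qed.

Definition segment U V a m m' x y : Prop :=
  [/\ fspan U x, fspan V y &
      forall i, if (m <= i < m')%N
        then near i (c i (if (a i).1.2 then y else x)) (a i).1.1 /\
             c i (if (a i).1.2 then x else y) = 0
        else c i x = 0 /\ c i y = 0].

(** Induction on the fixed point with the same two subspaces offered each time: the pieces are added
    to their own sides until the first completed pair, which is why only the last letter is
    flagged. *)
Lemma forces_reach s B : forces s B -> forall U V, fits U B -> fits V B ->
  exists a j x y, [/\ (0 < j)%N, s = mkseq a (cut B 0), segment U V a (cut B 0) (cut B j) x y,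
    forall i, (cut B 0 <= i < cut B j)%N ->
      (a i).1.1 \in grid i /\ (a i).2 = (i.+1 == cut B j) &
    live (mkseq a (cut B j)) (tail j B)].
Proof.
move=> fB; apply: (fB (fun s B => forall U V, fits U B -> fits V B ->
  exists a j x y, [/\ (0 < j)%N, s = mkseq a (cut B 0), segment U V a (cut B 0) (cut B j) x y,
    forall i, (cut B 0 <= i < cut B j)%N ->
      (a i).1.1 \in grid i /\ (a i).2 = (i.+1 == cut B j) &
    live (mkseq a (cut B j)) (tail j B)])) => {fB s B} s B h U V fU fV.
have [U' sU' UU'] := fU; have [V' sV' VV'] := fV.
have [b [s' [j [r o]]]] := h U' V' sU' sV'.
have e0 : cut (if b then V' else U') 0 = cut B 0.
  by case: (b); [case: sV'|case: sU'].
have j0 := reply_gt0 r e0.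
have [a [x [l [l0 el es es' [f1 f2 f3]]]]] := r.
have B0j : (cut B 0 < cut B j)%N by rewrite cut_monolt.
have ecut : (cut B j).-1.+1 = cut B j by rewrite prednK // (leq_ltn_trans _ B0j).
have fx : fspan (if b then V else U) x by case: (b) f1 => [/VV'|/UU'].
pose x1 := if b then 0 else x; pose y1 := if b then x else 0.
have seg1 a' : (forall i, (i < cut B j)%N -> a' i = a i) ->
    segment U V a' (cut B 0) (cut B j) x1 y1.
  move=> ea; split.
  - by rewrite /x1; case: (b) fx => // _; exact: fspan0.
  - by rewrite /y1; case: (b) fx => // _; exact: fspan0.
  - move=> i; case: ifP => i01; last first.
      by rewrite /x1 /y1; case: (b); rewrite (coef0 c_lin) f2 ?i01.
    rewrite ea; last by case/andP: i01.
    have [h1 h2 -> _] := f3 i i01.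
    by rewrite /x1 /y1; case: (b); rewrite (coef0 c_lin).
case: o => -[e o].
  exists a, j, x1, y1; split => //; last by rewrite -es'.
    exact: seg1.
  move=> i ij; have [h1 h2 h3 h4] := f3 i ij; split => //.
  apply/idP/idP => [/h4 -> //|/eqP e'].
  by move: e; rewrite es' -e' ended_mkseq.
have [a2 [j2 [x2 [y2 [j20 es2 [g1 g2 g3] fl lv]]]]] := o U V (fits_tail j fU) (fits_tail j fV).
have ea : forall i, (i < cut B j)%N -> a2 i = a i.
  by apply: mkseq_eq; rewrite -es' es2.
have Bjj : (cut B j < cut B (j2 + j))%N by rewrite cut_monolt -[ltnLHS]add0n ltn_add2r.
exists a2, (j2 + j)%N, (x1 + x2), (y1 + y2); split.
- by rewrite addn_gt0 j20.
- rewrite es; apply: eq_mkseq_lt => i i0; rewrite ea //; exact: ltn_trans i0 B0j.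
- have [p1 p2 p3] := seg1 a2 ea.
  split; [exact: fspanD|exact: fspanD|move=> i].
  have := p3 i; have := g3 i.
  have -> : (cut (tail j B) 0 <= i < cut (tail j B) j2)%N = (cut B j <= i < cut B (j2 + j))%N by [].
  case: (a2 i) => -[g sd] f /=.
  case: (ltnP i (cut B j)) => ij /=.
    move=> [q1 q2]; rewrite (ltn_trans ij Bjj) !andbT.
    by case: ifP => _; case: sd; rewrite !(coefD c_lin) ?q1 ?q2 !addr0.
  rewrite andbF (leq_trans (ltnW B0j) ij) /= => h1 [q1 q2]; move: h1.
  by case: ifP => _; case: sd; rewrite !(coefD c_lin) ?q1 ?q2 !add0r.
- move=> i /andP[i1 i2]; case: (ltnP i (cut B j)) => ij; last first.
    by have := fl i; rewrite /= ij i2; exact.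
  rewrite ea //; have [_ h2 _ h4] := f3 i (introT andP (conj i1 ij)); split => //.
  rewrite ltn_eqF; last exact: leq_ltn_trans ij Bjj.
  apply/negbTE/negP => fi; move/negP: e; apply.
  by rewrite es' -(h4 fi) ended_mkseq.
- exact: live_sub (sub_tailD j j2 B) lv.
Qed.

(** Each completed pair ends at a live position, from which the next pair is forced. Liveness also
    provides a good word through every position reached; this is all that is claimed here about
    goodness of the limit word. *)
Lemma strategy Z U V : stable Z -> cut Z 0 = 0%N -> live [::] Z -> sub U Z -> sub V Z ->
  exists (a : nat -> letter) (m : nat -> nat) (x y : nat -> X),
  [/\ m 0%N = 0%N, forall n, (m n < m n.+1)%N,
      forall i, (a i).2 <-> exists n, i.+1 = m n.+1,
      forall n, segment U V a (m n) (m n.+1) (x n) (y n) &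
      forall n, exists2 a', good a' & forall i, (i < m n)%N -> a' i = a i].
Proof.
move=> stZ Z0 lv sU sV.
pose ok (na : nat * (nat -> letter)) :=
  mkseq na.2 (cut Z na.1) \in words (cut Z na.1) /\
  live (mkseq na.2 (cut Z na.1)) (tail na.1 Z).
pose next (na na' : nat * (nat -> letter)) (xy : X * X) :=
  [/\ (na.1 < na'.1)%N, (forall i, (i < cut Z na.1)%N -> na'.2 i = na.2 i),
      segment U V na'.2 (cut Z na.1) (cut Z na'.1) xy.1 xy.2,
      (forall i, (cut Z na.1 <= i < cut Z na'.1)%N -> (na'.2 i).2 = (i.+1 == cut Z na'.1)) &
      ok na'].
have /choice[f fP] : forall na, exists p : (nat * (nat -> letter)) * (X * X),
    ok na -> next na p.1 p.2.
  move=> [n a]; have [[/= sw l]|nok] := pselect (ok (n, a)); last first.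
    by exists ((n, a), (0, 0)).
  have fo : forces (mkseq a (cut Z n)) (tail n Z).
    by apply: live_forces => //; exact: stable_tail.
  have [a' [j [x [y [j0 es seg fl lv']]]]] :=
    forces_reach fo (fits_tail n (fits_sub sU)) (fits_tail n (fits_sub sV)).
  have ea : forall i, (i < cut Z n)%N -> a' i = a i by apply: mkseq_eq; rewrite es.
  exists ((j + n, a'), (x, y))%N => _; split => //=.
  - by rewrite -[ltnLHS]add0n ltn_add2r.
  - by move=> i /fl[].
  - split => /=; last exact: live_sub (sub_tailD n j Z) lv'.
    apply/mem_words => i ij; case: (ltnP i (cut Z n)) => i0.
      by rewrite ea //; move: sw => /mem_words; exact.
    by have /fl[] : (cut (tail n Z) 0 <= i < cut (tail n Z) j)%N by rewrite i0.
pose fix C n := if n is n'.+1 then (f (C n')).1 else (0%N, fun=> (0, false, false)).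
have okC n : ok (C n).
  elim: n => [|n ih] /=; last by have [] := fP _ ih.
  rewrite /ok /= Z0; split; first by rewrite inE.
  by apply: live_sub lv; exact: sub_tail0.
have nx n := fP _ (okC n).
pose m n := cut Z (C n).1.
have mlt n : (m n < m n.+1)%N by rewrite cut_monolt; have [] := nx n.
have m0 : m 0%N = 0%N by rewrite /m /= Z0.
have mmono : {mono m : n n' / (n <= n')%N}.
  by apply: leq_mono; apply: homo_ltn => [???|]; [exact: ltn_trans|].
have mge n : (n <= m n)%N by elim: n => // n ih; exact: leq_ltn_trans ih (mlt n).
have agree n d i : (i < m n)%N -> (C (d + n)%N).2 i = (C n).2 i.
  elim: d => // d ih im; have [_ h _ _ _] := nx (d + n)%N.
  rewrite addSn h ?ih //; apply: (leq_trans im).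
  by rewrite -/(m _) mmono leq_addl.
(* Letter [i] is final from stage [i.+1] on, because [m i.+1] exceeds [i]. *)
pose a i := (C i.+1).2 i.
have aC n i : (i < m n)%N -> a i = (C n).2 i.
  move=> im; rewrite /a; case: (leqP i.+1 n) => h.
    by rewrite -(subnK h) (agree i.+1) // (leq_trans _ (mge i.+1)).
  by rewrite -(subnK (ltnW h)) (agree n).
exists a, m, (fun n => (f (C n)).2.1), (fun n => (f (C n)).2.2); split => //.
- move=> i; have [n inn] : exists n, (m n <= i < m n.+1)%N.
    have ex : exists n, (i < m n)%N by exists i.+1; exact: mge.
    case: (ex_minnP ex) => -[|n] h1 h2; first by rewrite m0 in h1.
    exists n; rewrite h1 andbT leqNgt; apply/negP => /h2.
    by rewrite ltnn.
  rewrite (aC n.+1); last by case/andP: inn.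
  have [_ _ _ h _] := nx n; rewrite [(C n.+1).2 i]/= h //; split.
    by move=> /eqP ->; exists n.
  move=> [k ek]; move: inn => /andP[h1 h2].
  have kn : (k.+1 <= n.+1)%N by rewrite -mmono -ek.
  have nk : (n < k.+1)%N by rewrite -(leqW_mono mmono) -ek ltnS.
  by rewrite ek; have -> : k = n by apply/eqP; rewrite eqn_leq -ltnS kn -ltnS nk.
- move=> n; have [_ _ [h1 h2 h3] _ _] := nx n; split => // i.
  by have := h3 i; case: ifP => // /andP[_ i2]; rewrite (aC n.+1).
- move=> n; have [_ l] := okC n; have [a' es ga] := live_good l.
  exists a' => // i im; rewrite (aC n) //.
  by apply/esym; exact: mkseq_eq es _ im.
Qed.

End Game.

(** * Real-valued norms over a real or complex field *)

(** What is needed of the scalars to treat the real and complex cases at once: norms in a copy of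
    [R], finite nets of balls for the grids, and completeness for limits of coordinates. *)
Record real_scalars (R : realType) (K : numFieldType) := RealScalars {
  rsc :> {rmorphism R -> K};
  rsc_le : forall r s, (rsc r <= rsc s) = (r <= s);
  rsc_norm : forall x : K, exists r, `|x| = rsc r;
  rsc_net : forall M eta : R, 0 < eta -> exists l : seq K,
    forall x : K, `|x| <= rsc M -> exists2 y, y \in l & `|x - y| <= rsc eta;
  rsc_complete : forall f : nat -> K,
    (forall eps : R, 0 < eps -> exists N, forall m n, (N <= m)%N -> (N <= n)%N ->
      `|f m - f n| < rsc eps) ->
    exists l, forall eps : R, 0 < eps -> exists N, forall n, (N <= n)%N -> `|l - f n| < rsc eps
}.

Section RealNorm.
Context {R : realType} {K : numFieldType} (S : real_scalars R K).

Lemma rsc_lt r s : (S r < S s) = (r < s).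
Proof. by rewrite !lt_def rsc_le (inj_eq (fmorph_inj S)). Qed.

Lemma rsc_gt0 (x : K) : 0 < x -> exists2 r, 0 < r & x = S r.
Proof.
move=> x0; have [r er] := rsc_norm S x; rewrite gtr0_norm // in er.
by exists r => //; rewrite -rsc_lt rmorph0 -er.
Qed.

(* When [K] is complex its order is only partial; [nrm] moves norms to [R]. *)
Definition nrm {V : normedZmodType K} (v : V) : R := xget 0 [set r | `|v| = S r].

Section NormedZmod.
Context {V : normedZmodType K}.
Implicit Types u v : V.

Lemma nrmE v : `|v| = S (nrm v).
Proof.
have [r er] := rsc_norm S `|v|; rewrite normr_id in er.
by apply: (@xgetPex R 0 [set r | `|v| = S r]); exists r.
Qed.

Lemma nrm_ge0 v : 0 <= nrm v.
Proof. by rewrite -(rsc_le S) rmorph0 -nrmE normr_ge0. Qed.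

Lemma nrm_eq0 v : (nrm v == 0) = (v == 0).
Proof. by rewrite -(inj_eq (fmorph_inj S)) -nrmE rmorph0 normr_eq0. Qed.

Lemma nrm0 : nrm (0 : V) = 0.
Proof. by apply/eqP; rewrite nrm_eq0. Qed.

Lemma nrm_gt0 v : (0 < nrm v) = (v != 0).
Proof. by rewrite lt_def nrm_ge0 andbT nrm_eq0. Qed.

Lemma nrmN v : nrm (- v) = nrm v.
Proof. by apply: (fmorph_inj S); rewrite -!nrmE normrN. Qed.

Lemma nrmB u v : nrm (u - v) = nrm (v - u).
Proof. by rewrite -nrmN opprB. Qed.

Lemma nrm_add u v : nrm (u + v) <= nrm u + nrm v.
Proof. by rewrite -(rsc_le S) rmorphD -!nrmE ler_normD. Qed.

Lemma nrm_sub u v : nrm (u - v) <= nrm u + nrm v.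
Proof. by rewrite (le_trans (nrm_add _ _)) // nrmN. Qed.

Lemma nrm_sum (I : Type) (r : seq I) (P : pred I) (F : I -> V) :
  nrm (\sum_(i <- r | P i) F i) <= \sum_(i <- r | P i) nrm (F i).
Proof.
elim/big_rec2: _ => [|i x y _ h]; first by rewrite nrm0.
by rewrite (le_trans (nrm_add _ _)) // lerD2l.
Qed.

End NormedZmod.

Lemma nrmM (x y : K) : nrm (x * y) = nrm x * nrm y.
Proof. by apply: (fmorph_inj S); rewrite rmorphM /= -!nrmE normrM. Qed.

Lemma nrmV (x : K) : nrm x^-1 = (nrm x)^-1.
Proof. by apply: (fmorph_inj S); rewrite fmorphV -!nrmE normfV. Qed.

Lemma nrm_rsc (r : R) : 0 <= r -> nrm (S r) = r.
Proof.
move=> r0; apply: (fmorph_inj S); rewrite -nrmE ger0_norm //.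
by rewrite -(rmorph0 S) rsc_le.
Qed.

Lemma nrmZ (X : normedModType K) (k : K) (v : X) : nrm (k *: v) = nrm k * nrm v.
Proof. by apply: (fmorph_inj S); rewrite rmorphM /= -!nrmE normrZ. Qed.

Section Topology.
Context {X : completeNormedModType K}.
Implicit Types (u v : X) (A V : set X).

Lemma nrm_lt v (eps : R) : (`|v| < S eps) = (nrm v < eps).
Proof. by rewrite nrmE rsc_lt. Qed.

Lemma cvg_nrmP (f : nat -> X) u : f @ \oo --> u <->
  forall eps : R, 0 < eps -> exists N, forall n, (N <= n)%N -> nrm (u - f n) < eps.
Proof.
split.
  move=> /cvgrPdist_lt h eps e0.
  have := h (S eps); rewrite -(rmorph0 S) rsc_lt => /(_ e0)[N _ hN].
  by exists N => n Nn; rewrite -nrm_lt; exact: hN.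
move=> h; apply/cvgrPdist_lt => eps /rsc_gt0[r r0 ->].
have [N hN] := h r r0; exists N => // n Nn /=.
by rewrite nrm_lt; exact: hN.
Qed.

Lemma closure_nrmP A u : closure A u <->
  forall eps : R, 0 < eps -> exists2 v, A v & nrm (u - v) < eps.
Proof.
split.
  move=> h eps e0.
  have Se0 : 0 < S eps by rewrite -(rmorph0 S) rsc_lt.
  have [v [Av]] := h _ (nbhsx_ballx u (S eps) Se0).
  by rewrite -ball_normE /ball_ /= nrm_lt; exists v.
move=> h B /nbhs_ballP[eps /= /rsc_gt0[r r0 ->] hB].
have [v Av uv] := h r r0; exists v; split => //; apply: hB.
by rewrite -ball_normE /ball_ /= nrm_lt.
Qed.

Lemma complete_nrm (f : nat -> X) :
  (forall eps : R, 0 < eps -> exists N, forall m n, (N <= m)%N -> (N <= n)%N ->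
    nrm (f m - f n) < eps) ->
  exists l, forall eps : R, 0 < eps -> exists N, forall n, (N <= n)%N -> nrm (l - f n) < eps.
Proof.
move=> h; suff /cvg_ex[l hl] : cvgn f by exists l; apply/cvg_nrmP.
apply: cauchy_cvg; apply/cauchyP => eps /rsc_gt0[r r0 ->].
have [N hN] := h r r0; exists (f N).
exists N => // n /= Nn; rewrite -ball_normE /ball_ /= nrm_lt.
exact: hN.
Qed.

Lemma within_nrmP V (T : X -> X) : {within V, continuous T} <->
  forall u, V u -> forall eps : R, 0 < eps -> exists2 d : R, 0 < d &
    forall v, V v -> nrm (u - v) < d -> nrm (T u - T v) < eps.
Proof.
rewrite subspace_continuousP; split.
  move=> h u Vu eps e0; have /cvgrPdist_lt := h u Vu.
  have Se0 : 0 < S eps by rewrite -(rmorph0 S) rsc_lt.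
  move=> /(_ _ Se0); rewrite /within /= => /nbhs_ballP[d /= /rsc_gt0[r r0 ->] hd].
  exists r => // v Vv uv; rewrite -nrm_lt; apply: hd => //.
  by rewrite -ball_normE /ball_ /= nrm_lt.
move=> h u Vu; apply/cvgrPdist_lt => eps /rsc_gt0[r r0 ->].
have [d d0 hd] := h u Vu r r0.
rewrite /within /=; apply/nbhs_ballP; exists (S d) => /=.
  by rewrite -(rmorph0 S) rsc_lt.
move=> v; rewrite -ball_normE /ball_ /= nrm_lt => uv Vv.
by rewrite nrm_lt; exact: hd.
Qed.

End Topology.
End RealNorm.

Section Nets.
Context (R : realType).

Lemma real_net (M eta : R) : 0 < eta -> exists l : seq R,
  forall x : R, `|x| <= M -> exists2 y, y \in l & `|x - y| <= eta.
Proof.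
move=> e0; pose n := (Num.truncn (M / eta)).+2.
exists [seq eta * (i%:R - n%:R) | i <- iota 0 (n + n)] => x xM.
have M0 : 0 <= M by apply: le_trans xM.
have nM : M / eta < n%:R - 1 by rewrite /n -[(Num.truncn _).+2]addn1 natrD addrK; exact: truncnS_gt.
pose t := x / eta + n%:R.
have xe : `|x / eta| < n%:R - 1.
  by rewrite (le_lt_trans _ nM) // normrM normfV (gtr0_norm e0) ler_pM2r ?invr_gt0.
have [t0 t1] : 0 <= t /\ t < n%:R + n%:R.
  by move: xe; rewrite ltr_norml /t => /andP[? ?]; split; lra.
pose i := Num.truncn t; have /truncn_itv /andP[i1 i2] := t0.
exists (eta * (i%:R - n%:R)).
  apply/mapP; exists i => //; rewrite mem_iota /= add0n.
  by rewrite -(ltr_nat R) natrD; exact: le_lt_trans i1 t1.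
have -> : x - eta * (i%:R - n%:R) = eta * (t - i%:R).
  by rewrite /t; field; rewrite gt_eqF.
rewrite normrM gtr0_norm // ler_piMr ?ltW // ger0_norm ?subr_ge0 //.
by move: i2; rewrite -natr1 -/i; lra.
Qed.

End Nets.

Lemma real_complete (R : realType) (f : nat -> R) :
  (forall eps : R, 0 < eps -> exists N, forall m n, (N <= m)%N -> (N <= n)%N ->
    `|f m - f n| < eps) ->
  exists l, forall eps : R, 0 < eps -> exists N, forall n, (N <= n)%N -> `|l - f n| < eps.
Proof.
move=> h; suff /cvg_ex[l /cvgrPdist_lt hl] : cvgn (f : nat -> R^o).
  by exists l => eps /hl[N _ hN]; exists N => n; exact: hN.
apply: cauchy_cvg; apply/cauchyP => eps e0.
have [N hN] := h eps e0; exists (f N).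
by exists N => // n /= Nn; rewrite -ball_normE /ball_ /=; exact: hN.
Qed.

Lemma real_scalars_real (R : realType) : real_scalars R R.
Proof.
apply: (@RealScalars R R idfun) => //; first by move=> x; exists `|x|.
  by move=> M eta; exact: real_net.
exact: real_complete.
Qed.

Lemma real_scalars_complex (R : realType) : real_scalars R R[i].
Proof.
have normc_lt (a b r : R) : `|a| < r / 2 -> `|b| < r / 2 -> `|(a +i* b)%C| < r%:C%C.
  move=> aa bb; rewrite normc_def ltcR /=.
  have r0 : 0 < r by have := le_lt_trans (normr_ge0 a) aa; lra.
  rewrite -[ltRHS]ger0_norm ?(ltW r0) // -sqrtr_sqr ltr_sqrt ?exprn_gt0 //.
  by move: aa bb; rewrite !ltr_norml => /andP[? ?] /andP[? ?]; nra.
have le_normc (a b : R) : `|a|%:C%C <= `|(a +i* b)%C| /\ `|b|%:C%C <= `|(a +i* b)%C|.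
  rewrite normc_def !lecR /= -!sqrtr_sqr; split.
    by rewrite ler_wsqrtr // lerDl sqr_ge0.
  by rewrite ler_wsqrtr // lerDr sqr_ge0.
apply: (@RealScalars R R[i] (real_complex R)).
- by move=> r s /=; rewrite lecR.
- by move=> x; rewrite normc_def; eexists.
- move=> M eta e0; have e40 : 0 < eta / 4 by rewrite divr_gt0.
  have [l hl] := real_net M e40.
  exists [seq (a +i* b)%C | a <- l, b <- l] => -[a b] xM.
  have [ha hb] := le_normc a b.
  have [a' al aa] : exists2 y, y \in l & `|a - y| <= eta / 4.
    by apply: hl; rewrite -lecR (le_trans ha).
  have [b' bl bb] : exists2 y, y \in l & `|b - y| <= eta / 4.
    by apply: hl; rewrite -lecR (le_trans hb).
  exists (a' +i* b')%C; first by apply/allpairsP; exists (a', b').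
  by apply/ltW/normc_lt; [rewrite (le_lt_trans aa)|rewrite (le_lt_trans bb)]; lra.
- move=> f h.
  have [|la hla] := @real_complete R (fun n => complex.Re (f n)).
    move=> eps /h[N hN]; exists N => m n Nm Nn; rewrite -ltcR.
    apply: le_lt_trans (hN m n Nm Nn).
    by case: (f m) (f n) => [a b] [a' b'] /=; have [] := le_normc (a - a') (b - b').
  have [|lb hlb] := @real_complete R (fun n => complex.Im (f n)).
    move=> eps /h[N hN]; exists N => m n Nm Nn; rewrite -ltcR.
    apply: le_lt_trans (hN m n Nm Nn).
    by case: (f m) (f n) => [a b] [a' b'] /=; have [] := le_normc (a - a') (b - b').
  exists (la +i* lb)%C => eps e0; have e20 : 0 < eps / 2 by rewrite divr_gt0.
  have [N1 h1] := hla _ e20; have [N2 h2] := hlb _ e20; exists (maxn N1 N2) => n.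
  rewrite geq_max => /andP[/h1 n1 /h2 n2].
  by move: n1 n2; case: (f n) => a b /=; exact: normc_lt.
Qed.

(** * Schauder bases *)

Section Estimates.
Context {R : realType}.

Lemma half_small (C eps : R) : 0 < eps -> exists k, C * 2^-1 ^+ k < eps.
Proof.
move=> e0; pose k := (Num.truncn (C / eps)).+1; exists k.
have k2 : k%:R <= 2 ^+ k :> R by rewrite -natrX ler_nat ltnW // ltn_expl.
have Ck : C / eps < k%:R by exact: truncnS_gt.
rewrite exprVn ltr_pdivrMr ?exprn_gt0 // mulrC -ltr_pdivrMr //.
exact: lt_le_trans k2.
Qed.

Lemma sum_half (n : nat) : \sum_(i < n) 2^-1 ^+ i.+1 < 1 :> R.
Proof.
suff -> : \sum_(i < n) 2^-1 ^+ i.+1 = 1 - 2^-1 ^+ n :> R.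
  by have : 0 < 2^-1 ^+ n :> R by []; lra.
elim: n => [|n ih]; first by rewrite big_ord0 expr0 subrr.
by rewrite big_ord_recr /= ih exprS; lra.
Qed.

Lemma le_of_lt_add (a b : R) : (forall eps, 0 < eps -> a <= b + eps) -> a <= b.
Proof. by move=> h; apply/ler_addgt0Pr. Qed.

End Estimates.

Section Schauder.
Context {R : realType} {K : numFieldType} (S : real_scalars R K).
Context {X : completeNormedModType K} (e : nat -> X) (basis_e : schauder_basis e).
Implicit Types (u v : X) (a : nat -> K).

Local Notation nrm := (nrm S).

Definition cf i u : K := Defs.coord e u i.
Definition basis_proj n u : X := \sum_(i < n) cf i u *: e i.

Local Notation proj := basis_proj.

Lemma expansionP u a : expansion e u a <->
  forall eps : R, 0 < eps -> exists N, forall n, (N <= n)%N ->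
    nrm (u - \sum_(i < n) a i *: e i) < eps.
Proof.
rewrite /expansion; split=> [/(cvg_nrmP S) h eps /h [N hN]|h].
  by exists N => n /hN; rewrite /series /= big_mkord.
apply/(cvg_nrmP S) => eps /h[N hN]; exists N => n /hN.
by rewrite /series /= big_mkord.
Qed.

Lemma coord_expansion u : expansion e u (Defs.coord e u).
Proof.
have [a [ha _]] := basis_e u.
by apply: (@xgetPex _ (fun=> 0) [set a | expansion e u a]); exists a.
Qed.

Lemma coord_unique u a : expansion e u a -> Defs.coord e u = a.
Proof.
move=> ha; have [b [_ hb]] := basis_e u.
by rewrite -(hb _ ha) -(hb _ (@coord_expansion u)).
Qed.

Lemma proj_cvg u (eps : R) : 0 < eps -> exists N, forall n, (N <= n)%N ->
  nrm (u - proj n u) < eps.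
Proof. by have /expansionP := @coord_expansion u; exact. Qed.

Lemma cf_lin i (k : K) u v : cf i (k *: u + v) = k * cf i u + cf i v.
Proof.
rewrite /cf (@coord_unique _ (fun n => k * Defs.coord e u n + Defs.coord e v n)) //.
apply/expansionP => eps e0.
have k0 : 0 < nrm k + 1 by rewrite ltr_wpDl // nrm_ge0.
have [N1 h1] := proj_cvg u (divr_gt0 (divr_gt0 e0 (ltr0n _ 2)) k0).
have [N2 h2] := proj_cvg v (divr_gt0 e0 (ltr0n _ 2)).
exists (maxn N1 N2) => n; rewrite geq_max => /andP[/h1 {}h1 /h2 {}h2].
have -> : k *: u + v - \sum_(j < n) (k * Defs.coord e u j + Defs.coord e v j) *: e j =
    k *: (u - proj n u) + (v - proj n v).
  rewrite scalerBr addrACA -opprD; congr (_ - _).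
  rewrite scaler_sumr -big_split /=; apply: eq_bigr => j _.
  by rewrite scalerDl scalerA.
rewrite (le_lt_trans (nrm_add _ _ _)) // nrmZ.
have : nrm k * nrm (u - proj n u) <= (nrm k + 1) * nrm (u - proj n u).
  by rewrite ler_wpM2r ?nrm_ge0 // lerDl.
have : (nrm k + 1) * nrm (u - proj n u) < eps / 2 by rewrite mulrC -ltr_pdivlMr.
lra.
Qed.

Lemma cfB i u v : cf i (u - v) = cf i u - cf i v.
Proof. by rewrite addrC -scaleN1r cf_lin mulN1r addrC. Qed.

Lemma cf_comb i n a : cf i (\sum_(j < n) a j *: e j) = if (i < n)%N then a i else 0.
Proof.
rewrite /cf (@coord_unique _ (fun j => if (j < n)%N then a j else 0)) //.
apply/expansionP => eps e0; exists n => m nm.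
by rewrite (fspan_pad e a nm) subrr nrm0.
Qed.

Lemma cf_e i j : cf i (e j) = (i == j)%:R.
Proof.
have -> : e j = \sum_(l < j.+1) (if l == j :> nat then 1 else 0) *: e l.
  rewrite big_ord_recr /= eqxx scale1r big1 ?add0r // => l _.
  by rewrite ltn_eqF // scale0r.
rewrite (cf_comb i j.+1 (fun l => if l == j then 1 else 0)) /= ltnS.
by case: eqP => [->|_]; rewrite ?leqnn //; case: ifP.
Qed.

Lemma e_neq0 i : e i != 0.
Proof.
apply/eqP => h; have := cf_e i i; rewrite h eqxx (coef0 cf_lin).
by move/esym/eqP; rewrite oner_eq0.
Qed.

Lemma proj_lin n (k : K) u v : proj n (k *: u + v) = k *: proj n u + proj n v.
Proof.
rewrite scaler_sumr -big_split /=; apply: eq_bigr => j _.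
by rewrite cf_lin scalerDl scalerA.
Qed.

Lemma proj_add n u v : proj n (u + v) = proj n u + proj n v.
Proof. by rewrite -[u]scale1r proj_lin !scale1r. Qed.

Lemma proj0 n : proj n 0 = 0.
Proof. by rewrite /proj big1 // => i _; rewrite (coef0 cf_lin) scale0r. Qed.

Lemma projZ n (k : K) u : proj n (k *: u) = k *: proj n u.
Proof. by rewrite -[k *: u]addr0 proj_lin proj0 addr0. Qed.

Lemma projN n u : proj n (- u) = - proj n u.
Proof. by rewrite -scaleN1r projZ scaleN1r. Qed.

Lemma cf_proj i n u : cf i (proj n u) = if (i < n)%N then cf i u else 0.
Proof. exact: cf_comb. Qed.

(** Balls of the norm $\sup_n \|P_n u\|$, where $P_n$ is [proj n]. Comparing it with the given norm
    yields the basis constant. *)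
Definition pbound (m : R) u : Prop := forall n, nrm (proj n u) <= m.

Lemma pbound_ex u : exists m, pbound m u.
Proof.
have [N hN] := proj_cvg u (@ltr01 R).
exists (nrm u + 1 + \sum_(n < N) nrm (proj n u)) => n.
have s0 : 0 <= \sum_(n < N) nrm (proj n u) by apply: sumr_ge0 => i _; exact: nrm_ge0.
case: (ltnP n N) => nN.
  rewrite (bigD1 (Ordinal nN)) //= in s0 *; rewrite addrCA lerDl.
  by rewrite addr_ge0 ?addr_ge0 ?nrm_ge0 // sumr_ge0 // => i _; exact: nrm_ge0.
have := hN n nN; have := nrm_add S (proj n u - u) u; rewrite subrK nrmB.
lra.
Qed.

Lemma pboundZ (m : R) (t : K) u : pbound m u -> pbound (nrm t * m) (t *: u).
Proof. by move=> h n; rewrite projZ nrmZ ler_wpM2l ?nrm_ge0. Qed.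

Lemma pboundB (m m' : R) u v : pbound m u -> pbound m' v -> pbound (m + m') (u - v).
Proof.
by move=> h h' n; rewrite proj_add projN (le_trans (nrm_sub _ _ _)) // lerD.
Qed.

(* Baire category: if every ball had a subball free of vectors with projections
   bounded by [m], nested balls would shrink to a vector with unbounded projections. *)
Lemma pbound_somewhere_dense : exists (m : R) u0 (r : R), 0 < r /\
  forall u, nrm (u - u0) < r -> forall d : R, 0 < d ->
    exists2 v, nrm (v - u) < d & pbound m v.
Proof.
apply: contrapT => hn.
have /choice[f fP] : forall mur : nat * (X * R), exists ur : X * R, 0 < mur.2.2 ->
    [/\ 0 < ur.2, ur.2 <= mur.1.+1%:R^-1, nrm (ur.1 - mur.2.1) + ur.2 <= mur.2.2 &
        forall v, nrm (v - ur.1) <= ur.2 -> ~ pbound mur.1%:R v].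
  move=> [m [u r]] /=; have [r0|] := boolP (0 < r); last by exists (u, r).
  apply: contrapT => hm; apply: hn; exists m%:R, u, r; split => // u' uu d d0.
  apply: contrapT => hv; apply: hm.
  pose r' := Num.min (d / 2) (Num.min (r - nrm (u' - u)) m.+1%:R^-1).
  have r'0 : 0 < r' by rewrite !lt_min divr_gt0 // subr_gt0 uu invr_gt0 ltr0n.
  have [r1 r2 r3] : [/\ r' <= d / 2, r' <= r - nrm (u' - u) & r' <= m.+1%:R^-1].
    by rewrite /r' !ge_min !lexx /= !orbT.
  exists (u', r') => _; split => //=; first by lra.
  move=> v vu pv; apply: hv; exists v => //; lra.
pose fix C n := if n is n'.+1 then f (n', C n') else (0 : X, 1 : R).
have C0 n : 0 < (C n).2.
  by elim: n => [|n ih] //=; have [] := fP (n, C n) ih.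
have CP n := fP (n, C n) (C0 n).
have near n d : nrm ((C (d + n)%N).1 - (C n).1) + (C (d + n)%N).2 <= (C n).2.
  elim: d => [|d ih]; first by rewrite add0n subrr nrm0 add0r.
  have [_ _ h _] := CP (d + n)%N; rewrite addSn /=.
  have := nrm_add S ((C (d + n).+1).1 - (C (d + n)%N).1) ((C (d + n)%N).1 - (C n).1).
  rewrite addrA subrK /=; move: h ih; rewrite /=; lra.
have near' n m : (n <= m)%N -> nrm ((C m).1 - (C n).1) <= (C n).2.
  by move=> nm; have := near n (m - n)%N; rewrite subnK //; have := C0 m; lra.
have [eps e0|l hl] := @complete_nrm _ _ S _ (fun n => (C n).1).
  pose N := (Num.truncn (2 / eps)).+1.
  have hN : (C N.+1).2 < eps / 2.
    have [_ h _ _] := CP N; apply: le_lt_trans h _.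
    rewrite -[eps / 2]invrK ltf_pV2 ?posrE ?ltr0n ?invr_gt0 ?divr_gt0 //.
    rewrite invf_div; apply: lt_trans (truncnS_gt _) _; rewrite ltr_nat.
    exact: ltnSn.
  exists N.+1 => m n /near' h1 /near' h2.
  have := nrm_sub S ((C m).1 - (C N.+1).1) ((C n).1 - (C N.+1).1).
  by rewrite opprB addrA subrK; lra.
have lC n : nrm (l - (C n).1) <= (C n).2.
  apply: le_of_lt_add => eps /hl[N hN].
  have h1 := hN (maxn N n) (leq_maxl _ _).
  have h2 := near' n (maxn N n) (leq_maxr _ _).
  have := nrm_add S (l - (C (maxn N n)).1) ((C (maxn N n)).1 - (C n).1).
  by rewrite addrA subrK; lra.
have [m hm] := pbound_ex l.
have [_ _ _ /(_ l (lC (Num.truncn m).+2))] := CP (Num.truncn m).+1.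
by apply => n; apply: le_trans (hm n) _; exact/ltW/truncnS_gt.
Qed.

(** With [t := r / (2 * rho)], both [t u + u0] and [u0] lie in the ball where [m]-bounded vectors
    are dense. The difference of two approximants has bound [2 * m], and dividing by [t] gives
    [4 * m / r * rho]. *)
Lemma pbound_dense : exists2 M : R, 0 < M & forall (rho : R) u, 0 < rho -> nrm u <= rho ->
  forall d : R, 0 < d -> exists2 v, nrm (u - v) < d & pbound (M * rho) v.
Proof.
have [m [u0 [r [r0 h]]]] := pbound_somewhere_dense.
have m0 : 0 <= m.
  have [|v _ /(_ 0%N)] := h u0 _ 1 ltr01; first by rewrite subrr nrm0.
  exact: le_trans (nrm_ge0 _ _).
exists (4 * m / r + 1); first by rewrite ltr_wpDl // divr_ge0 ?mulr_ge0 // ltW.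
move=> rho u rho0 urho d d0.
pose t := r / (2 * rho); have t0 : 0 < t by rewrite divr_gt0 // mulr_gt0.
have tu : nrm (S t *: u) < r.
  rewrite nrmZ nrm_rsc ?ltW // /t mulrC mulrA ltr_pdivrMr ?mulr_gt0 //.
  rewrite [ltRHS]mulrC ltr_pM2r //; lra.
have td : 0 < t * d / 2 by rewrite divr_gt0 // mulr_gt0.
have [|v1 h1 p1] := h (S t *: u + u0) _ _ td; first by rewrite addrK.
have [|v2 h2 p2] := h u0 _ _ td; first by rewrite subrr nrm0.
have St0 : S t != 0 by rewrite fmorph_eq0 gt_eqF.
exists ((S t)^-1 *: (v1 - v2)).
  have -> : u - (S t)^-1 *: (v1 - v2) = (S t)^-1 *: ((v2 - u0) - (v1 - (S t *: u + u0))).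
    have -> : v2 - u0 - (v1 - (S t *: u + u0)) = S t *: u - (v1 - v2).
      by rewrite !opprB addrA addrACA addNr addr0 [v2 + _]addrC -addrA.
    by rewrite [RHS]scalerBr scalerA mulVf // scale1r.
  rewrite nrmZ nrmV nrm_rsc ?(ltW t0) // mulrC ltr_pdivrMr //.
  have := nrm_sub S (v2 - u0) (v1 - (S t *: u + u0)); rewrite [d * t]mulrC.
  lra.
move=> n; have := pboundZ (S t)^-1 (pboundB p1 p2) n.
rewrite nrmV nrm_rsc ?(ltW t0) // => /le_trans; apply.
rewrite mulrDl mul1r /t invf_div.
have -> : 2 * rho / r * (m + m) = 4 * m / r * rho by field; rewrite gt_eqF.
by rewrite lerDl ltW.
Qed.

(* Successive approximation, as in the proof of the open mapping theorem. *)
Lemma proj_bounded_unit : exists M : R, forall u, nrm u <= 1 -> pbound M u.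
Proof.
have [M M0 hM] := pbound_dense; exists (2 * M) => u u1.
pose h k : R := 2^-1 ^+ k.
have h0 k : 0 < h k by rewrite /h.
have hS k : h k.+1 = h k / 2 by rewrite /h exprSr.
have /choice[f fP] : forall kw : nat * X, exists v, nrm kw.2 <= h kw.1 ->
    nrm (kw.2 - v) < h kw.1.+1 /\ pbound (M * h kw.1) v.
  move=> [k w] /=; have [hw|] := boolP (nrm w <= h k); last by exists 0.
  by have [v v1 v2] := hM _ _ (h0 k) hw _ (h0 k.+1); exists v.
pose fix w n := if n is n'.+1 then w n' - f (n', w n') else u.
have wh k : nrm (w k) <= h k.
  by elim: k => [|k ih] /=; [rewrite /h expr0|have [/ltW] := fP (k, w k) ih].
pose v k := f (k, w k); pose s k := \sum_(j < k) v j.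
have vb k : pbound (M * h k) (v k) by have [] := fP (k, w k) (wh k).
have us k : u - s k = w k.
  rewrite /s; elim: k => [|k ih]; first by rewrite big_ord0 subr0.
  by rewrite big_ord_recr /= opprD addrA ih.
(* The errors halve at each stage, so the projections of the partial sums differ by a geometric
   tail, uniformly in the index of the projection. *)
have sd k d : pbound (2 * M * h k) (s (d + k)%N - s k).
  move=> n; have vb' j : nrm (proj n (v j)) <= M * h j by exact: vb.
  suff : nrm (proj n (s (d + k)%N - s k)) <= 2 * M * (h k - h (d + k)%N).
    by move=> /le_trans; apply; rewrite ler_wpM2l ?mulr_ge0 ?(ltW M0) // gerBl ltW.
  elim: d => [|d ih].
    by rewrite add0n !subrr mulr0 proj0 nrm0.
  have -> : s (d.+1 + k)%N = s (d + k)%N + v (d + k)%N by rewrite /s addSn big_ord_recr.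
  rewrite addrAC proj_add.
  have := nrm_add S (proj n (s (d + k)%N - s k)) (proj n (v (d + k)%N)).
  have := vb' (d + k)%N; rewrite hS; move: ih; nra.
have cauchy i (eps : R) : 0 < eps -> exists N, forall m n, (N <= m)%N -> (N <= n)%N ->
    nrm (cf i (s m) - cf i (s n)) < eps.
  move=> e0; have ei : 0 < nrm (e i) by rewrite nrm_gt0 e_neq0.
  have [N hN] := half_small (8 * M) (mulr_gt0 e0 ei); exists N.
  have one m : (N <= m)%N -> nrm (cf i (s m) - cf i (s N)) * nrm (e i) <= 4 * M * h N.
    move=> Nm; rewrite -nrmZ.
    have -> : (cf i (s m) - cf i (s N)) *: e i = proj i.+1 (s m - s N) - proj i (s m - s N).
      by rewrite /proj big_ord_recr /= addrAC subrr add0r cfB.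
    have hm n : nrm (proj n (s m - s N)) <= 2 * M * h N.
      by have := sd N (m - N)%N n; rewrite subnK.
    by have := nrm_sub S (proj i.+1 (s m - s N)) (proj i (s m - s N));
       have := hm i; have := hm i.+1; lra.
  move=> m n /one hm /one hn; rewrite -(ltr_pM2r ei).
  have := nrm_sub S (cf i (s m) - cf i (s N)) (cf i (s n) - cf i (s N)).
  rewrite opprB addrA subrK -(ler_pM2r ei) mulrDl.
  by move: hN; rewrite -/(h N); lra.
have /choice[a ha] : forall i, exists l, forall eps : R, 0 < eps ->
    exists N, forall n, (N <= n)%N -> nrm (l - cf i (s n)) < eps.
  move=> i; have [eps e0|l hl] := @rsc_complete _ _ S (fun n => cf i (s n)).
    by have [N hN] := cauchy i _ e0; exists N => m n Nm Nn; rewrite (nrmE S) rsc_lt; exact: hN.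
  by exists l => eps /hl[N hN]; exists N => n /hN; rewrite (nrmE S) rsc_lt.
pose y n := \sum_(i < n) a i *: e i.
have yP n (eps : R) : 0 < eps -> exists N, forall k, (N <= k)%N -> nrm (y n - proj n (s k)) < eps.
  move: eps; elim: n => [|n ih] eps e0.
    by exists 0%N => k _; rewrite /y /proj !big_ord0 subrr nrm0.
  have ei : 0 < nrm (e n) by rewrite nrm_gt0 e_neq0.
  have [N1 h1] := ih _ (divr_gt0 e0 (ltr0n _ 2)).
  have [N2 h2] := ha n _ (divr_gt0 (divr_gt0 e0 (ltr0n _ 2)) ei).
  exists (maxn N1 N2) => k; rewrite geq_max => /andP[/h1 k1 /h2 k2].
  rewrite /y /proj !big_ord_recr /= -/(y n) -/(proj n _) opprD addrACA -scalerBl.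
  have := nrm_add S (y n - proj n (s k)) ((a n - cf n (s k)) *: e n).
  by move: k2; rewrite nrmZ ltr_pdivlMr //; lra.
have yb n k : nrm (y n - proj n (s k)) <= 2 * M * h k.
  apply: le_of_lt_add => eps /(yP n)[N hN].
  have := hN _ (leq_addr k N); have := sd k N n.
  have := nrm_add S (y n - proj n (s (N + k)%N)) (proj n (s (N + k)%N) - proj n (s k)).
  rewrite addrA subrK -projN -proj_add; lra.
have yn n : nrm (y n) <= 2 * M.
  have := yb n 0%N; rewrite /s big_ord0 /h expr0 mulr1.
  by rewrite proj0 subr0.
(* The limits of the coordinates of the partial sums form an expansion of [u]. By uniqueness they
   are the coordinates of [u], and [yn] becomes the claimed bound. *)
suff ea : expansion e u a by move=> n; rewrite /proj /cf (coord_unique ea) -/(y n).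
apply/expansionP => eps e0.
have [k hk] := half_small (2 * M + 1) (divr_gt0 e0 (ltr0n _ 2)).
have [N hN] := proj_cvg (s k) (divr_gt0 e0 (ltr0n _ 2)).
exists N => n /hN; rewrite -/(y n).
have := wh k; rewrite -us.
have := nrm_add S (u - s k) (s k - proj n (s k)); rewrite addrA subrK.
have := nrm_sub S (u - proj n (s k)) (y n - proj n (s k)).
rewrite opprB addrA subrK; have := yb n k; move: hk; rewrite mulrDl mul1r -/(h k); lra.
Qed.

Lemma proj_bounded : exists2 M : R, 1 <= M & forall n u, nrm (proj n u) <= M * nrm u.
Proof.
have [M hM] := proj_bounded_unit; exists (Num.max 1 M); first by rewrite le_max lexx.
move=> n u; have [->|u0] := eqVneq u 0.
  by rewrite proj0 nrm0 mulr0.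
have nu : 0 < nrm u by rewrite nrm_gt0.
have Su : S (nrm u) != 0 by rewrite fmorph_eq0 gt_eqF.
have := hM ((S (nrm u))^-1 *: u) _ n.
rewrite projZ !nrmZ nrmV nrm_rsc ?nrm_ge0 // mulVf ?gt_eqF // => /(_ (lexx _)).
rewrite mulrC ler_pdivrMr // => /le_trans; apply.
by rewrite ler_wpM2r ?nrm_ge0 // le_max lexx orbT.
Qed.

End Schauder.

(** * Closed spans of block sequences *)

Lemma subspace_lin (K : numFieldType) (X : completeNormedModType K) (V : set X) :
  closed_subspace V -> V 0 /\ forall (a : K) u v, V u -> V v -> V (a *: u + v).
Proof.
move=> [[h0 h1] _]; split; first exact/set_mem.
by move=> a u v Vu Vv; apply/set_mem/h1; exact/mem_set.
Qed.

(* Otherwise the common kernel of the functionals is trivial, so that V embeds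
   linearly in [K^N]; vectors whose images have maximal rank then span V. *)
Lemma common_kernel (K : numFieldType) (X : completeNormedModType K) (V : set X)
    (N : nat) (D : nat -> X -> K) :
  inf_dim_subspace V ->
  (forall j (a : K) u v, V u -> V v -> D j (a *: u + v) = a * D j u + D j v) ->
  exists v, [/\ V v, v != 0 & forall j, (j < N)%N -> D j v = 0].
Proof.
move=> [/subspace_lin[V0 Vlin] infV] Dlin; apply: contrapT => hn; apply: infV.
pose rowD v : 'rV[K]_N := \row_j D j v.
have inj v : V v -> rowD v = 0 -> v = 0.
  move=> Vv /rowP h; apply: contrapT => /eqP v0; apply: hn; exists v; split => // j jN.
  by have := h (Ordinal jN); rewrite !mxE.
have Vsum n (v : 'I_n -> X) (c : 'I_n -> K) : (forall i, V (v i)) ->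
    V (\sum_i c i *: v i) /\ rowD (\sum_i c i *: v i) = \sum_i c i *: rowD (v i).
  move=> Vv; elim/big_rec2: _ => [|i x y _ [Vy <-]].
    split => //; apply/rowP => j; rewrite !mxE.
    by have := Dlin j (-1) 0 0 V0 V0; rewrite scaler0 addr0 mulN1r addNr.
  split; first exact: Vlin.
  by apply/rowP => j; rewrite !mxE Dlin.
pose P r := `[< exists n (v : 'I_n -> X), (forall i, V (v i)) /\
  \rank (\matrix_(i < n) rowD (v i)) = r >].
have exP : exists r, P r.
  exists (\rank (\matrix_(i < 0) rowD 0)); apply/asboolP.
  by exists 0%N, (fun=> 0).
have leP r : P r -> (r <= N)%N by move=> /asboolP[n [v [_ <-]]]; exact: rank_leq_col.
case: (ex_maxnP exP leP) => r /asboolP[n [v [Vv rv]]] mx.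
exists n, v; apply/seteqP; split => u; last by move=> [c ->]; have [] := Vsum n v c Vv.
move=> Vu; set A := \matrix_(i < n) rowD (v i) in rv.
have sub : (rowD u <= A)%MS.
  apply: contrapT => /negP nsub.
  pose v' (i : 'I_(1 + n)) := match fintype.split i with inl _ => u | inr j => v j end.
  have : (\rank (col_mx (rowD u) A) <= r)%N.
    apply: mx; apply/asboolP; exists (1 + n)%N, v'; split.
      by move=> i; rewrite /v'; case: (fintype.split i).
    congr (\rank _); apply/row_matrixP => i; rewrite rowK /v'.
    rewrite -(splitK i); case: (fintype.split i) => j; rewrite unsplitK /=.
      by rewrite rowKu row_id.
    by rewrite rowKd rowK.
  rewrite -rv -addsmxE; apply/negP; rewrite -ltnNge.
  apply: rank_ltmx.
  by rewrite ltmxE addsmxSr addsmx_sub (negPf nsub).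
case/submxP: sub => cA eA; exists (fun i => cA 0 i).
have [Vs es] := Vsum n v (fun i => cA 0 i) Vv.
apply/eqP; rewrite -subr_eq0 -oppr_eq0 opprB; apply/eqP.
have -> : \sum_(i < n) cA 0 i *: v i - u = (-1) *: u + \sum_(i < n) cA 0 i *: v i.
  by rewrite scaleN1r addrC.
apply: inj; first exact: Vlin.
have -> : rowD (-1 *: u + \sum_(i < n) cA 0 i *: v i) =
    - rowD u + rowD (\sum_(i < n) cA 0 i *: v i).
  by apply/rowP => j; rewrite !mxE Dlin // mulN1r.
rewrite es eA mulmx_sum_row.
by under [X in _ + X]eq_bigr => i _ do rewrite -(rowK (fun i => rowD (v i))); rewrite addNr.
Qed.

Section BlockSums.
Context {R : realType} {K : numFieldType} (S : real_scalars R K).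
Context {X : completeNormedModType K} (e : nat -> X) (basis_e : schauder_basis e).
Context (M : R) (M1 : 1 <= M).
Local Notation nrm := (nrm S).
Local Notation cf := (cf e).
Local Notation proj := (basis_proj e).
Hypothesis projM : forall n u, nrm (proj n u) <= M * nrm u.
Implicit Types (u v : X) (w x y : nat -> X) (a t : nat -> K).

Let cfl := cf_lin S basis_e.

Let M0 : 0 < M. Proof. exact: lt_le_trans M1. Qed.

Lemma cf_ext u v : (forall i, cf i u = cf i v) -> u = v.
Proof.
move=> h; apply/eqP; rewrite -subr_eq0 -(nrm_eq0 S) eq_le nrm_ge0 andbT.
apply: le_of_lt_add => eps e0; have e20 : 0 < eps / 2 by rewrite divr_gt0.
have [N hN] := proj_cvg S basis_e u e20; have [N' hN'] := proj_cvg S basis_e v e20.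
have := hN _ (leq_maxl N N'); have := hN' _ (leq_maxr N N'); set n := maxn N N'.
have -> : proj n v = proj n u by apply: eq_bigr => i _; rewrite h.
have := nrm_sub S (u - proj n u) (v - proj n u).
by rewrite opprB addrA subrK; lra.
Qed.

Lemma cf_bound i u : nrm (cf i u) * nrm (e i) <= 2 * M * nrm u.
Proof.
rewrite -nrmZ.
have -> : cf i u *: e i = proj i.+1 u - proj i u.
  by rewrite /basis_proj big_ord_recr /= addrAC subrr add0r.
have := nrm_sub S (proj i.+1 u) (proj i u); have := projM i.+1 u; have := projM i u.
lra.
Qed.

Lemma proj_id n u : (forall i, (n <= i)%N -> cf i u = 0) -> proj n u = u.
Proof.
move=> h; apply: cf_ext => i; rewrite (cf_proj S basis_e).
by case: ltnP => // /h.
Qed.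

Definition supported (m : nat -> nat) x : Prop :=
  forall k i, ~~ (m k <= i < m k.+1)%N -> cf i (x k) = 0.

Lemma supported_comb (m : nat -> nat) x n t k : (forall k, (m k < m k.+1)%N) ->
  supported m x -> (k < n)%N ->
  proj (m k.+1) (\sum_(j < n) t j *: x j) - proj (m k) (\sum_(j < n) t j *: x j) = t k *: x k.
Proof.
move=> mlt sx kn; apply: cf_ext => i.
rewrite (cfB S basis_e) !(cf_proj S basis_e) (coef_sum cfl) (coefZ cfl).
have mm : {mono m : p q / (p <= q)%N}.
  by apply: leq_mono; apply: homo_ltn => [???|]; [exact: ltn_trans|].
case: (ltnP i (m k)) => ik.
  by rewrite (ltn_trans ik) // subrr sx ?mulr0 // leqNgt ik.
rewrite subr0; case: ltnP => ik1; last by rewrite sx ?mulr0 // ltnNge ik1 andbF.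
rewrite (bigD1 (Ordinal kn)) //= big1 ?addr0 ?(coefZ cfl) // => j jk.
rewrite (coefZ cfl) sx ?mulr0 //; apply: contra jk => /andP[j1 j2].
have a1 : (k < j.+1)%N by rewrite -(leqW_mono mm) (leq_ltn_trans ik).
have a2 : (j < k.+1)%N by rewrite -(leqW_mono mm) (leq_ltn_trans j1).
by apply/eqP/val_inj => /=; apply/eqP; rewrite eqn_leq -ltnS a2 -ltnS a1.
Qed.

Lemma supported_bound (m : nat -> nat) x n t k : (forall k, (m k < m k.+1)%N) ->
  supported m x -> (k < n)%N ->
  nrm (t k) * nrm (x k) <= 2 * M * nrm (\sum_(j < n) t j *: x j).
Proof.
move=> mlt sx kn; rewrite -nrmZ -(supported_comb t mlt sx kn); set z := \sum_(j < n) _.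
have := nrm_sub S (proj (m k.+1) z) (proj (m k) z).
have := projM (m k.+1) z; have := projM (m k) z; lra.
Qed.

Lemma closed_spanP w u : closed_span w u <->
  forall eps : R, 0 < eps -> exists2 v, fspan w v & nrm (u - v) < eps.
Proof. exact: (closure_nrmP S). Qed.

Lemma closed_span_vanish w (D : X -> K) (C : R) u :
  (forall u v, D (u - v) = D u - D v) -> (forall u, nrm (D u) <= C * nrm u) ->
  (forall v, fspan w v -> D v = 0) -> closed_span w u -> D u = 0.
Proof.
move=> DB DC Dw /closed_spanP hu.
apply/eqP; rewrite -(nrm_eq0 S) eq_le nrm_ge0 andbT.
apply: le_of_lt_add => eps e0; rewrite add0r.
have C1 : 0 < `|C| + 1 by rewrite ltr_wpDl.
have [v wv uv] := hu _ (divr_gt0 e0 C1).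
have := DC (u - v); rewrite DB (Dw v wv) subr0 => /le_trans; apply.
apply: le_trans (_ : (`|C| + 1) * nrm (u - v) <= _).
  by rewrite ler_wpM2r ?nrm_ge0 // (le_trans (ler_norm C)) // lerDl.
by move: uv; rewrite ltr_pdivlMr // mulrC => /ltW.
Qed.

Lemma cf_continuous i : exists C : R, forall u, nrm (cf i u) <= C * nrm u.
Proof.
have ei : 0 < nrm (e i) by rewrite nrm_gt0 (e_neq0 S basis_e).
exists (2 * M / nrm (e i)) => u; rewrite mulrAC ler_pdivlMr //; exact: cf_bound.
Qed.

Lemma fspan_closed w u : fspan w u -> closed_span w u.
Proof.
by move=> wu; apply/closed_spanP => eps e0; exists u => //; rewrite subrr nrm0.
Qed.

Variant closed_span_coefs (B : blocks cf) u (a : nat -> K) : Prop :=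
  ClosedSpanCoefs of (forall i, (i < cut B 0)%N -> cf i u = 0)
  & (forall j i, (cut B j <= i < cut B j.+1)%N -> cf i u = a j * cf i (B j)).

(** Being proportional to [B j] between two cuts means that certain bounded functionals, the
    determinants [D], vanish; this passes to the closure. The coefficient is read at a pivot of
    [B j]. *)
Lemma closed_span_coefsP (B : blocks cf) u : closed_span B u ->
  exists a, closed_span_coefs B u a.
Proof.
move=> Bu.
have /choice[p hp] : forall j, exists i, (cut B j <= i < cut B j.+1)%N /\ cf i (B j) != 0.
  by move=> j; have [i ? ?] := vec_pivot B j; exists i.
exists (fun j => cf (p j) u / cf (p j) (B j)); split => [i i0|j i ij].
  have [C hC] := cf_continuous i.
  apply: (closed_span_vanish _ hC _ Bu); first exact: (cfB S basis_e).
  by move=> v Bv; apply: (coef_fspan0 cfl Bv).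
have [pj pnz] := hp j.
have [C1 h1] := cf_continuous i; have [C2 h2] := cf_continuous (p j).
pose D v := cf i v * cf (p j) (B j) - cf (p j) v * cf i (B j).
have D0 : D u = 0.
  apply: (@closed_span_vanish B D
    (C1 * nrm (cf (p j) (B j)) + C2 * nrm (cf i (B j)))) => //.
  - by move=> v v'; rewrite /D !(cfB S basis_e); ring.
  - move=> v; rewrite (le_trans (nrm_sub _ _ _)) // !nrmM mulrDl.
    by rewrite ![_ * nrm (cf _ _) * _]mulrAC lerD // ler_wpM2r ?nrm_ge0.
  - move=> v [n [a ->]]; rewrite /D (coef_comb cfl _ _ ij) (coef_comb cfl _ _ pj).
    by ring.
apply: (mulIf pnz); rewrite [RHS]mulrAC divfK //.
by apply/eqP; rewrite -subr_eq0; apply/eqP.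
Qed.

Lemma proj_closed_span (B : blocks cf) u J : closed_span B u -> fspan B (proj (cut B J) u).
Proof.
move=> /closed_span_coefsP[a [h0 h1]]; exists J, a.
apply: cf_ext => i; rewrite (cf_proj S basis_e).
case: (ltnP i (cut B 0)) => i0; first by rewrite h0 // (coef_comb0 cfl) // if_same.
have [j ij] := cut_find i0; rewrite (coef_comb cfl _ _ ij) (h1 j) //.
have [/andP[j1 j2]] := ij; case: (ltnP j J) => jJ.
  by rewrite (leq_trans j2) // (cut_mono B).
rewrite mul0r ltnNge (leq_trans _ j1) // (cut_mono B) //.
Qed.

Lemma closed_span_finite (B : blocks cf) u n : closed_span B u ->
  (forall i, (n <= i)%N -> cf i u = 0) -> fspan B u.
Proof.
move=> Bu h; have := proj_closed_span n Bu.
rewrite proj_id // => i ni; apply: h; exact: leq_trans (cut_ge B n) ni.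
Qed.

Lemma closed_span_approx (B : blocks cf) u n (eps : R) : closed_span B u -> 0 < eps ->
  (forall i, (i < n)%N -> cf i u = 0) -> exists (z : X) m,
    [/\ fspan B z, nrm (u - z) < eps & forall i, ~~ (n <= i < m)%N -> cf i z = 0].
Proof.
move=> Bu e0 h; have [N hN] := proj_cvg S basis_e u e0.
exists (proj (cut B N) u), (cut B N); split.
- exact: proj_closed_span.
- apply: hN; exact: cut_ge.
- move=> i; rewrite (cf_proj S basis_e) negb_and -ltnNge.
  by case: ifP => // _; rewrite orbF => /h.
Qed.

(** Gliding hump for [v] and [T v] together: some nonzero vector of [V] is killed by the first [n]
    coordinates of both. It is scaled to norm [L], and both it and its image are truncated, the
    supports fitting between two common cuts of [B]. *)
Lemma block_sequences (V : set X) (T : X -> X) (B B1 B2 : blocks cf) (d : nat -> R) (L : R) :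
  inf_dim_subspace V -> linear_on V T ->
  (forall v, V v -> closed_span B1 v) -> (forall v, V v -> closed_span B2 (T v)) ->
  (forall k, 0 < d k) -> 0 < L ->
  exists (v x y : nat -> X) (r : nat -> nat),
   [/\ forall k, V (v k) /\ nrm (v k) = L,
       forall k, fspan B1 (x k) /\ fspan B2 (y k),
       forall k, nrm (v k - x k) < d k /\ nrm (T (v k) - y k) < d k &
       [/\ forall k, (r k < r k.+1)%N, r 0%N = 0%N,
           supported (cut B \o r) x & supported (cut B \o r) y]].
Proof.
move=> infV linT VB1 VB2 d0 L0.
have [V0 Vlin] := subspace_lin (proj1 infV).
have /choice[f fP] : forall kr : nat * nat, exists q : (X * X * X) * nat,
   [/\ V q.1.1.1 /\ nrm q.1.1.1 = L, fspan B1 q.1.1.2 /\ fspan B2 q.1.2,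
       nrm (q.1.1.1 - q.1.1.2) < d kr.1 /\ nrm (T q.1.1.1 - q.1.2) < d kr.1,
       (kr.2 < q.2)%N &
       forall i, ~~ (cut B kr.2 <= i < cut B q.2)%N -> cf i q.1.1.2 = 0 /\ cf i q.1.2 = 0].
  move=> [k r] /=; set n := cut B r.
  have [|v [Vv v0 hv]] := @common_kernel _ _ V (n + n)
      (fun j u => if (j < n)%N then cf j u else cf (j - n) (T u)) infV.
    by move=> j a u u' Vu Vu'; rewrite linT // !cfl; case: ifP.
  have nv : 0 < nrm v by rewrite nrm_gt0.
  pose c := S (L / nrm v); pose v' := c *: v.
  have Vv' : V v' by rewrite /v' -[_ *: _]addr0; exact: Vlin.
  have Tv' : T v' = c *: T v.
    have T0 : T 0 = 0 by have := linT (-1) 0 0 V0 V0; rewrite scaler0 addr0 scaleN1r addNr.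
    by rewrite /v' -[c *: v]addr0 linT // T0 addr0.
  have z1 i : (i < n)%N -> cf i v' = 0.
    move=> i1; have := hv i (leq_trans i1 (leq_addl _ _)).
    by rewrite i1 /v' (coefZ cfl) => ->; rewrite mulr0.
  have z2 i : (i < n)%N -> cf i (T v') = 0.
    move=> i1; have := hv (i + n)%N; rewrite ltn_add2r i1 ltnNge leq_addl /= addnK.
    by rewrite Tv' (coefZ cfl) => ->; rewrite ?mulr0.
  have [x [m [x1 x2 x3]]] := closed_span_approx (VB1 _ Vv') (d0 k) z1.
  have [y [m' [y1 y2 y3]]] := closed_span_approx (VB2 _ Vv') (d0 k) z2.
  exists ((v', x, y), maxn r.+1 (maxn m m')); split => //=.
  - by rewrite /v' nrmZ nrm_rsc ?divfK ?gt_eqF // ltW // divr_gt0.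
  - by rewrite leq_max leqnn.
  - move=> i; rewrite -/n; set m0 := maxn r.+1 _.
    have mm : (m <= cut B m0)%N.
      by rewrite (leq_trans _ (cut_ge B m0)) // /m0 !leq_max leqnn !orbT.
    have mm' : (m' <= cut B m0)%N.
      by rewrite (leq_trans _ (cut_ge B m0)) // /m0 !leq_max leqnn !orbT.
    move=> hi; split; [apply: x3|apply: y3]; apply: contra hi => /andP[-> h] /=.
      exact: leq_trans mm.
    exact: leq_trans mm'.
pose fix r n := if n is n'.+1 then (f (n', r n')).2 else 0%N.
pose q k := (f (k, r k)).1.
exists (fun k => (q k).1.1), (fun k => (q k).1.2), (fun k => (q k).2), r.
split; try by move=> k; have [] := fP (k, r k).
split => //; first by move=> k; have [] := fP (k, r k).
  by move=> k i; have [_ _ _ _ h] := fP (k, r k); move=> /h[].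
by move=> k i; have [_ _ _ _ h] := fP (k, r k); move=> /h[].
Qed.

End BlockSums.

(** * Equivalent sequences *)

Section Equivalence.
Context {R : realType} {K : numFieldType} (S : real_scalars R K).
Context {X : completeNormedModType K}.
Local Notation nrm := (nrm S).
Implicit Types (u v : X) (w x y : nat -> X) (t : nat -> K).

Definition lc n t x : X := \sum_(k < n) t k *: x k.

Definition small t : Prop := forall k, nrm (t k) <= 1.

Definition dominated (C : R) n x y : Prop :=
  forall t, small t -> nrm (lc n t x) <= C * (1 + nrm (lc n t y)).

Definition bounded_below (L : R) n x : Prop :=
  forall t, small t -> forall k, (k < n)%N -> nrm (t k) = 1 -> L <= nrm (lc n t x).

(* Up to constants, this is equivalence of [x 0, ..., x (n - 1)] and [y 0, ..., y (n - 1)];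
   the additive slack makes it stable under summable perturbations. *)
Definition equivalent (C L : R) n x y : Prop :=
  [/\ dominated C n x y, dominated C n y x, bounded_below L n x & bounded_below L n y].

Definition close n x x' : Prop := forall t, small t -> nrm (lc n t x - lc n t x') <= 1.

Definition comparable n x x' : Prop := forall t,
  nrm (lc n t x') <= 2 * nrm (lc n t x) /\ nrm (lc n t x) <= 2 * nrm (lc n t x').

Lemma lc_pad n m t x : (n <= m)%N -> lc n t x = lc m (fun k => if (k < n)%N then t k else 0) x.
Proof. exact: fspan_pad. Qed.

Lemma lcZ n (k : K) t x : lc n (fun j => k * t j) x = k *: lc n t x.
Proof. by rewrite /lc scaler_sumr; apply: eq_bigr => j _; rewrite scalerA. Qed.

Lemma lcD n t t' x : lc n (fun j => t j + t' j) x = lc n t x + lc n t' x.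
Proof. by rewrite /lc -big_split; apply: eq_bigr => j _; rewrite scalerDl. Qed.

Lemma lc_fspan n t x : fspan x (lc n t x).
Proof. by exists n, t. Qed.

Lemma eq_lc n t t' x x' : (forall k, (k < n)%N -> t k = t' k) ->
  (forall k, (k < n)%N -> x k = x' k) -> lc n t x = lc n t' x'.
Proof. by move=> ht hx; apply: eq_bigr => k _; rewrite ht // hx. Qed.

Lemma equivalent_eq (C L : R) n x x' y y' : (forall k, (k < n)%N -> x k = x' k) ->
  (forall k, (k < n)%N -> y k = y' k) -> equivalent C L n x y -> equivalent C L n x' y'.
Proof.
move=> hx hy [d1 d2 b1 b2].
have ex t : lc n t x' = lc n t x by apply: eq_lc => // k /hx.
have ey t : lc n t y' = lc n t y by apply: eq_lc => // k /hy.
by split => t st; rewrite ?ex ?ey; [exact: d1|exact: d2|exact: b1|exact: b2].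
Qed.

Lemma equivalentW (C C' L : R) n x y : C <= C' -> equivalent C L n x y -> equivalent C' L n x y.
Proof.
move=> CC [d1 d2 b1 b2]; split => // t st.
  by rewrite (le_trans (d1 t st)) // ler_wpM2r // addr_ge0 ?nrm_ge0.
by rewrite (le_trans (d2 t st)) // ler_wpM2r // addr_ge0 ?nrm_ge0.
Qed.

Lemma closeC n x x' : close n x x' -> close n x' x.
Proof. by move=> h t st; rewrite nrmB h. Qed.

(** The slack absorbs both errors: $\|x'\| \le \|x\|+1 \le C(2+\|y'\|)+1 \le (2C+1)(1+\|y'\|)$,
    writing $x$, $x'$, $y'$ for the combinations. *)
Lemma dominated_close (C : R) n x x' y y' : 0 <= C -> close n x x' -> close n y y' ->
  dominated C n x y -> dominated (2 * C + 1) n x' y'.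
Proof.
move=> C0 ha hb d t st.
have h1 : nrm (lc n t x') <= nrm (lc n t x) + 1.
  by have := nrm_sub S (lc n t x) (lc n t x - lc n t x'); rewrite subKr; have := ha t st; lra.
have h2 : nrm (lc n t y) <= nrm (lc n t y') + 1.
  have := nrm_add S (lc n t y') (lc n t y - lc n t y'); rewrite addrC subrK.
  by have := hb t st; lra.
have := d t st; have := nrm_ge0 S (lc n t y'); nra.
Qed.

Lemma bounded_below_close (L : R) n x x' : close n x x' -> bounded_below L n x ->
  bounded_below (L - 1) n x'.
Proof.
move=> ha b t st k kn tk; have := b t st k kn tk.
have := nrm_add S (lc n t x') (lc n t x - lc n t x'); rewrite addrC subrK.
by have := ha t st; lra.
Qed.

Lemma equivalent_close (C L : R) n x x' y y' : 0 <= C -> close n x x' -> close n y y' ->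
  equivalent C L n x y -> equivalent (2 * C + 1) (L - 1) n x' y'.
Proof.
move=> C0 hx hy [d1 d2 b1 b2]; split.
- exact: dominated_close d1.
- exact: dominated_close d2.
- exact: bounded_below_close b1.
- exact: bounded_below_close b2.
Qed.

Lemma equivalent_shift (C L : R) d x y : (forall n, equivalent C L n x y) ->
  forall n, equivalent C L n (fun k => x (k + d)%N) (fun k => y (k + d)%N).
Proof.
move=> h n; pose sh t k := if (k < d)%N then 0 else t (k - d)%N : K.
have lcE t z : lc n t (fun k => z (k + d)%N) = lc (d + n) (sh t) z.
  rewrite /lc big_split_ord /= [X in X + _]big1 ?add0r => [|k _]; last first.
    by rewrite /sh ltn_ord scale0r.
  by apply: eq_bigr => k _; rewrite /sh ltnNge leq_addr /= addKn addnC.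
have sm t : small t -> small (sh t).
  by move=> st k; rewrite /sh; case: ifP => // _; rewrite nrm0.
have low z : bounded_below L (d + n) z -> bounded_below L n (fun k => z (k + d)%N).
  move=> b t st k kn tk; rewrite lcE; apply: (b _ (sm _ st) (d + k)%N).
    by rewrite ltn_add2l.
  by rewrite /sh ltnNge leq_addr /= addKn.
have [d1 d2 b1 b2] := h (d + n)%N.
split; [| |exact: low|exact: low] => t st; rewrite !lcE.
  exact: d1 (sm _ st).
exact: d2 (sm _ st).
Qed.

Lemma equivalent_comparable (C L : R) n x x' y y' : 0 <= C ->
  comparable n x x' -> comparable n y y' ->
  equivalent C L n x y -> equivalent (4 * C) (L / 2) n x' y'.
Proof.
move=> C0.
have dom a a' b b' : comparable n a a' -> comparable n b b' -> dominated C n a b ->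
    dominated (4 * C) n a' b'.
  move=> ha hb d t st; have [h1 _] := ha t; have [_ h2] := hb t.
  have := d t st; have := nrm_ge0 S (lc n t b'); nra.
have low a a' : comparable n a a' -> bounded_below L n a -> bounded_below (L / 2) n a'.
  move=> ha b t st k kn tk; have := b t st k kn tk; have [_ h1] := ha t; lra.
move=> hx hy [d1 d2 b1 b2]; split.
- exact: dom d1.
- exact: dom d2.
- exact: low b1.
- exact: low b2.
Qed.

Lemma max_coef n t : exists m : R, [/\ 0 <= m, forall k, (k < n)%N -> nrm (t k) <= m &
  m = 0 \/ exists2 k, (k < n)%N & nrm (t k) = m].
Proof.
elim: n => [|n [m [m0 h1 h2]]]; first by exists 0; split => //; left.
have [le|lt] := leP (nrm (t n)) m.
  exists m; split => //; last first.
    by case: h2 => [->|[k kn ek]]; [left|right; exists k => //; exact: ltnW].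
  by move=> k; rewrite ltnS leq_eqVlt => /orP[/eqP ->|/h1].
exists (nrm (t n)); split; first exact: nrm_ge0.
  move=> k; rewrite ltnS leq_eqVlt => /orP[/eqP -> //|/h1] h.
  exact: le_trans h (ltW lt).
by right; exists n.
Qed.

Lemma normalize n t : (forall k, (k < n)%N -> t k = 0) \/
  exists (m : R) t', [/\ 0 < m, small t', exists2 k, (k < n)%N & nrm (t' k) = 1,
    (forall k, (k < n)%N -> nrm (t k) <= m) & forall x, lc n t x = S m *: lc n t' x].
Proof.
have [m [m0 h1 h2]] := max_coef n t.
have [e0|me] := eqVneq m 0.
  left => k kn; apply/eqP; rewrite -(nrm_eq0 S) eq_le nrm_ge0 andbT -e0; exact: h1.
have {m0}m0 : 0 < m by rewrite lt_def me.
have Sm : S m != 0 by rewrite fmorph_eq0.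
right; exists m, (fun k => if (k < n)%N then (S m)^-1 * t k else 0); split => //.
- move=> k; case: ifP => kn; last by rewrite nrm0.
  by rewrite nrmM nrmV nrm_rsc ?(ltW m0) // mulrC ler_pdivrMr // mul1r h1.
- case: h2 => [e0|[k kn ek]]; first by rewrite e0 eqxx in me.
  by exists k => //; rewrite kn nrmM nrmV nrm_rsc ?(ltW m0) // ek mulVf.
- move=> x; rewrite -lcZ; apply: eq_lc => // k kn.
  by rewrite kn mulrA mulfV // mul1r.
Qed.

Lemma bounded_below_coef n x t k : bounded_below 1 n x -> (k < n)%N ->
  nrm (t k) <= nrm (lc n t x).
Proof.
move=> b kn; have [h|[m [t' [m0 st [j jn tj] hm e]]]] := normalize n t.
  by rewrite h // nrm0 nrm_ge0.
rewrite e nrmZ nrm_rsc ?(ltW m0) //; apply: (le_trans (hm k kn)).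
by rewrite ler_peMr ?(ltW m0) // (b t' st j).
Qed.

(** After scaling the largest coefficient to modulus 1, the lower bound gives $1 \le \|y\|$ for the
    combination $y$, so $1+\|y\| \le 2\|y\|$ and the slack disappears. *)
Lemma dominated_homogeneous (C : R) n x y t : 0 <= C ->
  dominated C n x y -> bounded_below 1 n y -> nrm (lc n t x) <= 2 * C * nrm (lc n t y).
Proof.
move=> C0 d b; have [h|[m [t' [m0 st [j jn tj] hm e]]]] := normalize n t.
  have -> : lc n t x = 0 by rewrite /lc big1 // => k _; rewrite h // scale0r.
  by rewrite nrm0 !mulr_ge0 // nrm_ge0.
rewrite !e !nrmZ nrm_rsc ?(ltW m0) // mulrCA ler_wpM2l ?(ltW m0) //.
have := d t' st; have := b t' st j jn tj; nra.
Qed.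

(* The closure of the graph of the linear map sending each [x k] to [y k]. *)
Definition corresponds x y u v : Prop := forall eps : R, 0 < eps -> exists n t,
  nrm (u - lc n t x) < eps /\ nrm (v - lc n t y) < eps.

Lemma correspondsC x y u v : corresponds x y u v -> corresponds y x v u.
Proof. by move=> h eps /h[n [t [? ?]]]; exists n, t. Qed.

Lemma corresponds_closed_span x y u v : corresponds x y u v -> closed_span x u.
Proof.
move=> h; apply/(closed_spanP S) => eps /h[n [t [? _]]].
by exists (lc n t x) => //; exact: lc_fspan.
Qed.

Lemma corresponds_lin x y (k : K) u v u' v' : corresponds x y u v -> corresponds x y u' v' ->
  corresponds x y (k *: u + u') (k *: v + v').
Proof.
move=> h h' eps e0.
have k0 : 0 < nrm k + 1 by rewrite ltr_wpDl // nrm_ge0.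
have e20 : 0 < eps / 2 by rewrite divr_gt0.
have [n [t [h1 h2]]] := h _ (divr_gt0 e20 k0); have [n' [t' [h1' h2']]] := h' _ e20.
exists (maxn n n').
exists (fun j => k * (if (j < n)%N then t j else 0) + (if (j < n')%N then t' j else 0)).
rewrite !lcD !lcZ -!(lc_pad _ _ (leq_maxl n n')) -!(lc_pad _ _ (leq_maxr n n')).
have est z z' s s' : nrm (z - s) < eps / 2 / (nrm k + 1) -> nrm (z' - s') < eps / 2 ->
    nrm (k *: z + z' - (k *: s + s')) < eps.
  rewrite ltr_pdivlMr // => a b.
  have -> : k *: z + z' - (k *: s + s') = k *: (z - s) + (z' - s').
    by rewrite opprD addrACA scalerBr.
  rewrite (le_lt_trans (nrm_add _ _ _)) // nrmZ.
  have := nrm_ge0 S (z - s); nra.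
by split; exact: est.
Qed.

Lemma corresponds_bound (C : R) x y u v : 0 <= C ->
  (forall n t, nrm (lc n t y) <= C * nrm (lc n t x)) ->
  corresponds x y u v -> nrm v <= C * nrm u.
Proof.
move=> C0 hC h; apply: le_of_lt_add => eps e0.
have C1 : 0 < C + 1 by rewrite ltr_wpDl.
have [n [t [h1 h2]]] := h _ (divr_gt0 e0 C1).
have a1 := nrm_add S (v - lc n t y) (lc n t y); rewrite subrK in a1.
have a2 := nrm_sub S u (u - lc n t x); rewrite subKr in a2.
have := hC n t; move: h1 h2; set d := eps / (C + 1) => h1 h2.
have ed : d * (C + 1) = eps by rewrite /d divfK // gt_eqF.
by nra.
Qed.

Lemma corresponds_ex (C : R) x y u : 0 <= C ->
  (forall n t, nrm (lc n t y) <= C * nrm (lc n t x)) ->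
  closed_span x u -> exists v, corresponds x y u v.
Proof.
move=> C0 hC /(closed_spanP S) hu.
have h0 k : 0 < (2^-1 : R) ^+ k by [].
have /choice[f fP] : forall k : nat, exists nt : nat * (nat -> K),
    nrm (u - lc nt.1 nt.2 x) < 2^-1 ^+ k.
  by move=> k; have [_ [n [t ->]] h] := hu _ (h0 k); exists (n, t).
pose z w k := lc (f k).1 (f k).2 w.
have zB k l : nrm (z y k - z y l) <= C * nrm (z x k - z x l).
  pose n := maxn (f k).1 (f l).1.
  pose t j := (if (j < (f k).1)%N then (f k).2 j else 0) +
              (-1) * (if (j < (f l).1)%N then (f l).2 j else 0).
  have zt w : z w k - z w l = lc n t w.
    rewrite /t lcD lcZ scaleN1r -!lc_pad ?leq_maxl ?leq_maxr //.
  by rewrite !zt.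
have hdec k l : (k <= l)%N -> (2^-1 : R) ^+ l <= 2^-1 ^+ k.
  by move=> kl; apply: ler_wiXn2l => //; lra.
have [eps e0|v hv] := @complete_nrm _ _ S _ (z y).
  have [N hN] := half_small (2 * C) e0; exists N => m n Nm Nn.
  apply: le_lt_trans (zB m n) _.
  have := nrm_sub S (u - z x n) (u - z x m).
  rewrite opprB addrC addrA subrK; have := hdec _ _ Nm; have := hdec _ _ Nn.
  have := fP m; have := fP n; rewrite -!/(z x _); nra.
exists v => eps e0.
have [N hN] := hv _ e0; have [N' hN'] := half_small 1 e0.
exists (f (maxn N N')).1, (f (maxn N N')).2; split; last exact: hN (leq_maxl _ _).
apply: lt_trans (fP _) _; apply: le_lt_trans (hdec _ _ (leq_maxr N N')) _.
by rewrite -[X in X < _]mul1r.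
Qed.

Lemma equivalent_isomorphic (C : R) x y : 0 <= C -> (forall n, equivalent C 1 n x y) ->
  isomorphic (closed_span x) (closed_span y).
Proof.
move=> C0 hE; have C20 : 0 <= 2 * C by rewrite mulr_ge0.
have hx n t : nrm (lc n t x) <= 2 * C * nrm (lc n t y).
  by have [d _ _ b] := hE n; exact: dominated_homogeneous.
have hy n t : nrm (lc n t y) <= 2 * C * nrm (lc n t x).
  by have [_ d b _] := hE n; exact: dominated_homogeneous.
have /choice[T hT] : forall u, exists v, closed_span x u -> corresponds x y u v.
  move=> u; have [h|h] := pselect (closed_span x u); last by exists 0.
  by have [v hv] := corresponds_ex C20 hy h; exists v.
have /choice[T' hT'] : forall v, exists u, closed_span y v -> corresponds x y u v.
  move=> v; have [h|h] := pselect (closed_span y v); last by exists 0.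
  by have [u hu] := corresponds_ex C20 hx h; exists u => _; exact: correspondsC.
have subl w w' u v u' v' : corresponds w w' u v -> corresponds w w' u' v' ->
    corresponds w w' (u - u') (v - v').
  by move=> h h'; have := corresponds_lin (-1) h' h; rewrite !scaleN1r ![- _ + _]addrC.
have uniq2 u v v' : corresponds x y u v -> corresponds x y u v' -> v = v'.
  move=> h h'; apply/eqP; rewrite -subr_eq0 -(nrm_eq0 S) eq_le nrm_ge0 andbT.
  have := corresponds_bound C20 hy (subl _ _ _ _ _ _ h h').
  by rewrite subrr nrm0 mulr0.
have uniq1 u u' v : corresponds x y u v -> corresponds x y u' v -> u = u'.
  move=> /correspondsC h /correspondsC h'.
  apply/eqP; rewrite -subr_eq0 -(nrm_eq0 S) eq_le nrm_ge0 andbT.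
  have := corresponds_bound C20 hx (subl _ _ _ _ _ _ h h').
  by rewrite subrr nrm0 mulr0.
have Tspan u : closed_span x u -> closed_span y (T u).
  by move=> /hT/correspondsC/corresponds_closed_span.
have T'span v : closed_span y v -> closed_span x (T' v).
  by move=> /hT'/corresponds_closed_span.
have lip (F : X -> X) (V : set X) : (forall u v, V u -> V v ->
    nrm (F u - F v) <= 2 * C * nrm (u - v)) -> {within V, continuous F}.
  move=> h; apply/(within_nrmP S) => u Vu eps e0.
  have C1 : 0 < 2 * C + 1 by rewrite ltr_wpDl.
  exists (eps / (2 * C + 1)); first exact: divr_gt0.
  move=> v Vv; rewrite ltr_pdivlMr // => uv.
  apply: le_lt_trans (h u v Vu Vv) _; have := nrm_ge0 S (u - v); lra.
exists T, T'; split.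
- by split.
- split=> [u /set_mem xu|v /set_mem yv].
    exact: (uniq1 _ _ (T u)) (hT' _ (Tspan _ xu)) (hT _ xu).
  exact: (uniq2 (T' v)) (hT _ (T'span _ yv)) (hT' _ yv).
- move=> k u v xu xv.
  have h := corresponds_lin k (hT u xu) (hT v xv).
  exact: (uniq2 _ _ _ (hT _ (corresponds_closed_span h)) h).
- apply: lip => u v xu xv; apply: corresponds_bound C20 hy _.
  exact: subl (hT _ xu) (hT _ xv).
- apply: lip => u v yu yv; apply: corresponds_bound C20 hx _.
  by apply: subl; apply: correspondsC; exact: hT'.
Qed.

Lemma closed_span_subspace x : closed_subspace (closed_span x).
Proof.
split; last exact: closed_closure.
have lin (k : K) u v : closed_span x u -> closed_span x v -> closed_span x (k *: u + v).
  have h (w : X) : closed_span x w -> corresponds x x w w.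
    move=> /(closed_spanP S) hw eps /hw[_ [n [t ->]] wt].
    by exists n, t; split.
  move=> /h hu /h hv; exact: corresponds_closed_span (corresponds_lin k hu hv).
split; first by apply/mem_set; apply: (fspan_closed S); exact: fspan0.
by move=> k u v /set_mem hu /set_mem hv; apply/mem_set; exact: lin.
Qed.

Lemma closed_span_sub (V : set X) x : closed_subspace V -> (forall k, V (x k)) ->
  closed_span x `<=` V.
Proof.
move=> cV Vx u xu; have [V0 Vlin] := subspace_lin cV.
have : closure V u; last by rewrite -(proj1 (closure_id V) (proj2 cV)).
apply/(closure_nrmP S) => eps e0.
have [_ [n [t ->]] h] := proj1 (closed_spanP S x u) xu eps e0.
exists (\sum_(i < n) t i *: x i) => //.
by elim/big_rec: _ {h} => // i z _ Vz; exact: Vlin.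
Qed.

(** If [N] vectors spanned, the coefficients of [N.+1] terms of [x] would form a matrix with a
    nonzero left kernel vector, which is a linear relation. *)
Lemma independent_inf_dim x :
  (forall n t, lc n t x = 0 -> forall k, (k < n)%N -> t k = 0) ->
  inf_dim_subspace (closed_span x).
Proof.
move=> b; split; first exact: closed_span_subspace.
move=> [N [v ev]].
have /choice[A hA] : forall k, exists c : 'I_N -> K, x k = \sum_(i < N) c i *: v i.
  move=> k; have : closed_span x (x k) by apply: (fspan_closed S); exact: fspan_gen.
  by rewrite ev => -[c]; exists c.
pose MA : 'M[K]_(N.+1, N) := \matrix_(k, i) A k i.
have /rowV0Pn[c] : kermx MA != 0.
  by rewrite kermx_eq0 -row_leq_rank -ltnNge ltnS rank_leq_col.
rewrite sub_kermx => /eqP cA c0.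
have lc0 : lc N.+1 (fun k => c 0 (inord k)) x = 0.
  rewrite /lc; under eq_bigr => k _ do rewrite hA scaler_sumr.
  rewrite exchange_big big1 //= => i _.
  under eq_bigr => k _ do rewrite scalerA.
  rewrite -scaler_suml; have /rowP/(_ i) := cA; rewrite !mxE => ci.
  rewrite (_ : \sum_(k < N.+1) _ = 0) ?scale0r // -[RHS]ci.
  by apply: eq_bigr => k _; rewrite mxE inord_val.
have [k ck] := rV0Pn _ c0.
by have := b _ _ lc0 _ (ltn_ord k); rewrite inord_val => /eqP; rewrite (negPf ck).
Qed.

Lemma bounded_below_inf_dim x : (forall n, bounded_below 1 n x) ->
  inf_dim_subspace (closed_span x).
Proof.
move=> b; apply: independent_inf_dim => n t e0 k kn.
have := bounded_below_coef t (b n) kn; rewrite e0 nrm0 => h.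
by apply/eqP; rewrite -(nrm_eq0 S) eq_le h nrm_ge0.
Qed.

End Equivalence.

(** * Coding pairs of sequences by words *)

Section Interleave.
Context (m : nat -> nat).
Hypothesis m_lt : forall k, (m k < m k.+1)%N.
Hypothesis m0 : m 0%N = 0%N.

Lemma steps_mono : {mono m : p q / (p <= q)%N}.
Proof. by apply: leq_mono; apply: homo_ltn => [???|]; [exact: ltn_trans|]. Qed.

Lemma steps_ge k : (k <= m k)%N.
Proof. by elim: k => // k ih; exact: leq_ltn_trans ih (m_lt k). Qed.

Lemma steps_find i : exists k, (m k <= i < m k.+1)%N.
Proof.
have ex : exists n, (i < m n)%N by exists i.+1; exact: steps_ge.
case: (ex_minnP ex) => -[|n] h1 h2; first by rewrite m0 in h1.
exists n; rewrite h1 andbT leqNgt; apply/negP => /h2.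
by rewrite ltnn.
Qed.

Lemma steps_uniq i k l : (m k <= i < m k.+1)%N -> (m l <= i < m l.+1)%N -> k = l.
Proof.
move=> /andP[a b] /andP[a' b'].
have : (k < l.+1)%N by rewrite -(leqW_mono steps_mono) (leq_ltn_trans a).
have : (l < k.+1)%N by rewrite -(leqW_mono steps_mono) (leq_ltn_trans a').
by rewrite !ltnS => lk kl; apply/eqP; rewrite eqn_leq lk kl.
Qed.

Lemma steps_sum (V : nmodType) (F : nat -> V) n :
  \sum_(k < n) \sum_(m k <= i < m k.+1) F i = \sum_(0 <= i < m n) F i.
Proof.
elim: n => [|n ih]; first by rewrite big_ord0 m0 big_geq.
by rewrite big_ord_recr /= ih -big_cat_nat //; exact: ltnW.
Qed.

End Interleave.

(** The flags determine where pairs end. This identifies the division of a played word with that of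
    a good word agreeing with it on an initial segment. *)
Lemma steps_eq (m m' : nat -> nat) N :
  (forall k, (m k < m k.+1)%N) -> (forall k, (m' k < m' k.+1)%N) ->
  m 0%N = 0%N -> m' 0%N = 0%N ->
  (forall i, (i < m N)%N -> (exists n, i.+1 = m n.+1) <-> (exists n, i.+1 = m' n.+1)) ->
  forall k, (k <= N)%N -> m' k = m k.
Proof.
move=> ml ml' m0 m0' h; elim=> [|k ih] kN; first by rewrite m0 m0'.
have {}ih := ih (ltnW kN).
have mono := steps_mono ml; have mono' := steps_mono ml'.
have pos : (0 < m k.+1)%N by exact: leq_ltn_trans (ml k).
have le1 : (m' k.+1 <= m k.+1)%N.
  have : ((m k.+1).-1 < m N)%N by rewrite prednK // mono.
  move=> /h[h1 _]; have [|n en] := h1; first by exists k; rewrite prednK.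
  rewrite prednK // in en; rewrite en mono' -(leqW_mono mono') -en ih.
  exact: ml.
apply/eqP; rewrite eqn_leq le1 /=.
have pos' : (0 < m' k.+1)%N by exact: leq_ltn_trans (ml' k).
have : ((m' k.+1).-1 < m N)%N by rewrite prednK // (leq_trans le1) // mono.
move=> /h[_ h2]; have [|n en] := h2; first by exists k; rewrite prednK.
rewrite prednK // in en; rewrite en mono -(leqW_mono mono) -en -ih.
exact: ml'.
Qed.

Section Coding.
Context {R : realType} {K : numFieldType} (S : real_scalars R K).
Context {X : completeNormedModType K} (e : nat -> X) (basis_e : schauder_basis e).
Context (M : R) (M1 : 1 <= M).
Local Notation nrm := (nrm S).
Local Notation cf := (cf e).
Local Notation proj := (basis_proj e).
Hypothesis projM : forall n u, nrm (proj n u) <= M * nrm u.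
Implicit Types (u v : X) (x y : nat -> X) (a : nat -> letter (K := K)).

Let cfl := cf_lin S basis_e.

Let M0 : 0 < M. Proof. exact: lt_le_trans M1. Qed.

(* With these tolerances the errors made on all coordinates add up to at most 1. *)
Definition near i (z g : K) : Prop := nrm (z - g) * nrm (e i) <= 2^-1 ^+ i.+1.

(** The [i]-th coordinate of a vector of norm at most [C] has modulus at most
    [2 * M * C / nrm (e i)], so a finite net works for all such vectors, whatever blocks they come
    from. *)
Lemma near_grid (C : R) : exists grid : nat -> seq K,
  forall u i, nrm u <= C -> exists2 g, g \in grid i & near i (cf i u) g.
Proof.
have /choice[grid hg] : forall i, exists l : seq K,
    forall u, nrm u <= C -> exists2 g, g \in l & near i (cf i u) g.
  move=> i; have ei : 0 < nrm (e i) by rewrite nrm_gt0 (e_neq0 S basis_e).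
  have eta0 : 0 < (2^-1 : R) ^+ i.+1 / nrm (e i) by rewrite divr_gt0.
  have [l hl] := rsc_net S (2 * M * C / nrm (e i)) eta0; exists l => u uC.
  have [|g gl hg] := hl (cf i u).
    rewrite (nrmE S) rsc_le ler_pdivlMr // (le_trans (cf_bound projM i u)) //.
    by rewrite ler_wpM2l // mulr_ge0 // ltW.
  exists g => //; move: hg; rewrite (nrmE S) rsc_le /near.
  by rewrite ler_pdivlMr.
by exists grid => u i; exact: hg.
Qed.

Definition side_sum b a (m : nat -> nat) k : X :=
  \sum_(m k <= i < m k.+1 | (a i).1.2 == b) (a i).1.1 *: e i.

(** Coordinate [i] contributes an error of at most [2^-1 ^+ i.+1]. The intervals are disjoint and
    the coefficients have modulus at most 1, so the total is below 1. *)
Lemma close_side_sum b a (m : nat -> nat) x n : (forall k, (m k < m k.+1)%N) -> m 0%N = 0%N ->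
  supported e m x ->
  (forall k i, (m k <= i < m k.+1)%N ->
    if (a i).1.2 == b then near i (cf i (x k)) (a i).1.1 else cf i (x k) = 0) ->
  close S n x (side_sum b a m).
Proof.
move=> ml m0 sx hx t st.
have xE k : x k = \sum_(m k <= i < m k.+1) cf i (x k) *: e i.
  rewrite -[LHS](proj_id S basis_e (n := m k.+1)); last first.
    by move=> i ki; apply: sx; rewrite negb_and -leqNgt ki orbT.
  rewrite /basis_proj -(big_mkord xpredT (fun i => cf i (x k) *: e i)).
  rewrite (big_cat_nat _ (n := m k)) ?(ltnW (ml k)) //= big_nat_cond big1 ?add0r //.
  move=> i /andP[/andP[_ ik] _].
  by rewrite sx ?scale0r // leqNgt ik.
have dk k : nrm (x k - side_sum b a m k) <= \sum_(m k <= i < m k.+1) 2^-1 ^+ i.+1.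
  rewrite {1}xE /side_sum [X in _ - X]big_mkcond -sumrB /=.
  rewrite (le_trans (nrm_sum _ _ _ _)) //.
  apply: ler_sum_nat => i ik; have := hx k i ik.
  case: ifP => _; first by rewrite -scalerBl nrmZ.
  by move=> ->; rewrite scale0r subrr nrm0 exprn_ge0.
rewrite /lc -sumrB (le_trans (nrm_sum _ _ _ _)) //.
apply: le_trans (_ : \sum_(k < n) \sum_(m k <= i < m k.+1) 2^-1 ^+ i.+1 <= _).
  apply: ler_sum => k _; rewrite -scalerBr nrmZ.
  by apply: le_trans (dk k); rewrite ler_piMl ?nrm_ge0.
rewrite (steps_sum ml m0 (fun i => 2^-1 ^+ i.+1)) big_mkord.
exact/ltW/sum_half.
Qed.

(** The vectors are rebuilt from the letters alone, so the [n]-th condition depends only on letters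
    below [m n]; this gives the closedness used to pass to limit words. *)
Definition good (C : R) a : Prop := exists m : nat -> nat,
  [/\ m 0%N = 0%N, forall k, (m k < m k.+1)%N,
      forall i, (a i).2 <-> exists n, i.+1 = m n.+1 &
      forall n, equivalent S C 3 n (side_sum false a m) (side_sum true a m)].

Lemma good_flags C a : good C a -> forall l, exists2 i, (l <= i)%N & (a i).2.
Proof.
move=> [m [m0 ml fl _]] l.
have pos : (0 < m l.+1)%N by exact: leq_ltn_trans (ml l).
exists (m l.+1).-1; last by apply/fl; exists l; rewrite prednK.
by rewrite -ltnS prednK // steps_ge.
Qed.

(* A pair of disjointly supported equivalent block sequences inside [B]. *)
Definition has_pair (C : R) (B : blocks cf) : Prop := exists (x y : nat -> X) (r : nat -> nat),
  [/\ forall k, (r k < r k.+1)%N,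
      supported e (cut B \o r) x /\ supported e (cut B \o r) y,
      forall k, fspan B (x k) /\ fspan B (y k),
      forall k i, cf i (x k) = 0 \/ cf i (y k) = 0 &
      [/\ forall n, equivalent S C 4 n x y, forall k, nrm (x k) <= C &
          forall k, nrm (y k) <= C]].

(** On block [j] of [B], the two vectors are [al j] and [be j] times [B j], and disjointness kills
    one multiple. Hence their sum, of norm at most [C + C], can be rounded, and whether [be j] is
    nonzero decides the side. *)
Lemma has_pair_run (C : R) (B : blocks cf) (grid : nat -> seq K) : 0 <= C ->
  cut B 0 = 0%N -> has_pair C B ->
  (forall u i, nrm u <= C + C -> exists2 g, g \in grid i & near i (cf i u) g) ->
  exists2 a, run grid near B a & good (2 * C + 1) a.
Proof.
move=> C0 B0 [x [y [r0 [r0_lt [sx0 sy0] sp disj [eqv xC yC]]]]] hgrid.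
(* Words begin at coordinate 0, so the first interval is extended down to 0. *)
pose r k := if k is k'.+1 then r0 k else 0%N.
have r_lt k : (r k < r k.+1)%N.
  by case: k => [|k] /=; [exact: leq_ltn_trans (r0_lt 0%N)|exact: r0_lt].
have r_le k : (r k <= r0 k)%N by case: k.
pose m k := cut B (r k).
have m0 : m 0%N = 0%N by [].
have m_lt k : (m k < m k.+1)%N by rewrite cut_monolt.
have supp' z : supported e (cut B \o r0) z -> supported e m z.
  move=> h k i; case: k => [|k]; last exact: h.
  by move=> hi; apply: h; apply: contra hi => /andP[_ ->]; rewrite m0.
have sx := supp' _ sx0; have sy := supp' _ sy0.
have /choice[kk hkk] := steps_find m_lt m0.
have /choice[jj hjj] : forall i, exists j, (cut B j <= i < cut B j.+1)%N.
  by move=> i; apply: cut_find; rewrite B0.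
have kkE i k : (m k <= i < m k.+1)%N -> kk i = k by exact: steps_uniq.
have jjE i j : (cut B j <= i < cut B j.+1)%N -> jj i = j by exact: cut_uniq.
have /choice[g hg] : forall i, exists g,
    g \in grid i /\ near i (cf i (x (kk i) + y (kk i))) g.
  move=> i; have [|g ? ?] := hgrid (x (kk i) + y (kk i)) i; last by exists g.
  by rewrite (le_trans (nrm_add _ _ _)) // lerD.
have same i j : (cut B j <= i < cut B j.+1)%N -> kk i = kk (cut B j).
  move=> ij; apply: kkE; have /andP[h1 h2] := hkk (cut B j).
  rewrite /m !cut_mono cut_monolt in h1 h2 *.
  apply/andP; split; first by rewrite (leq_trans _ (proj1 (andP ij))) // cut_mono.
  by apply: leq_trans (proj2 (andP ij)) _; rewrite cut_mono.
have xcoef z : (forall k, fspan B (z k)) -> forall j, exists al, forall i,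
    (cut B j <= i < cut B j.+1)%N -> cf i (z (kk i)) = al * cf i (B j).
  move=> sz j; have [n [al eal]] := sz (kk (cut B j)).
  exists (if (j < n)%N then al j else 0) => i ij.
  by rewrite (same i j ij) eal (coef_comb cfl _ _ ij).
have /choice[al hal] := xcoef x (fun k => proj1 (sp k)).
have /choice[be hbe] := xcoef y (fun k => proj2 (sp k)).
have albe j : be j != 0 -> al j = 0.
  move=> bj; have [i ij ci] := vec_pivot B j.
  have := disj (kk i) i; rewrite (hal j i ij) (hbe j i ij) => -[] /eqP.
    by rewrite mulf_eq0 (negPf ci) orbF => /eqP.
  by rewrite mulf_eq0 (negPf ci) (negPf bj).
pose a i : letter := (g i, be (jj i) != 0, `[< exists n, i.+1 = m n.+1 >]).
exists a.
  move=> j; exists (al j + be j), (be j != 0) => i ij.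
  have [h1 h2] := hg i; split => //=; last 1 first.
  - move=> /asboolP[n en]; apply/eqP; rewrite eqn_leq (proj2 (andP ij)) /=.
    by rewrite en cut_mono -(cut_monolt B) -/(m n.+1) -en ltnS (proj1 (andP ij)).
  - by move: h2; rewrite (coefD cfl) (hal j i ij) (hbe j i ij) (coefZ cfl) mulrDl.
  - by rewrite (jjE i j).
exists m; split => //.
  by move=> i; split => [/asboolP|h]; [|exact/asboolP].
move=> n; have -> : 3 = 4 - 1 :> R by lra.
apply: equivalent_close (eqv n) => //.
  apply: close_side_sum => // k i ik; rewrite /= eqbF_neg negbK.
  have [h1 h2] := hg i; move: h2; rewrite (coefD cfl) (hal _ i (hjj i)) (hbe _ i (hjj i)).
  rewrite -(kkE _ _ ik) (hal _ i (hjj i)).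
  by case: eqVneq => [->|/albe ->]; rewrite mul0r // addr0.
apply: close_side_sum => // k i ik; rewrite /= eqb_id.
have [h1 h2] := hg i; move: h2; rewrite (coefD cfl) (hal _ i (hjj i)) (hbe _ i (hjj i)).
rewrite -(kkE _ _ ik) (hbe _ i (hjj i)).
by case: eqVneq => [->|/albe ->]; rewrite mul0r // add0r.
Qed.

End Coding.

(** * A quasi-minimal subspace *)

Section CaseA.
Context {R : realType} {K : numFieldType} (S : real_scalars R K).
Context {X : completeNormedModType K} (e : nat -> X) (basis_e : schauder_basis e).
Context (M : R) (M1 : 1 <= M).
Local Notation nrm := (nrm S).
Local Notation cf := (cf e).
Local Notation proj := (basis_proj e).
Hypothesis projM : forall n u, nrm (proj n u) <= M * nrm u.
Implicit Types (u v : X) (x y w : nat -> X) (B U Z : blocks cf).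

Let cfl := cf_lin S basis_e.

Let M0 : 0 < M. Proof. exact: lt_le_trans M1. Qed.

Lemma blocks_inf_dim B : inf_dim_subspace (closed_span B).
Proof.
apply: (independent_inf_dim S) => n t e0 k kn.
have sB : supported e (cut B) B by move=> j i; exact: vec_supp.
have := supported_bound basis_e projM t (cut_lt B) sB kn.
rewrite -/(lc n t B) e0 nrm0 mulr0 -nrmZ => h.
have : t k *: B k = 0 by apply/eqP; rewrite -(nrm_eq0 S) eq_le h nrm_ge0.
have [i _ ci] := vec_pivot B k => /(congr1 (cf i)).
rewrite (coefZ cfl) (coef0 cfl) => /eqP; rewrite mulf_eq0 (negPf ci) orbF.
by move=> /eqP.
Qed.

(** The [v k] have norm 2 and the blocks norm at least 1, so each coefficient of a combination of
    blocks is at most [2 * M] times its norm. The tolerances [d k] then sum to an error of at most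
    half that norm. *)
Lemma near_blocks (V : set X) B : inf_dim_subspace V -> V `<=` closed_span B -> cut B 0 = 0%N ->
  exists U (v : nat -> X), [/\ sub U B, forall k, V (v k) & forall n, comparable S n U v].
Proof.
move=> infV VB B0.
pose d k : R := 2^-1 ^+ k.+1 / (4 * M).
have M4 : 0 < 4 * M by rewrite mulr_gt0.
have d0 k : 0 < d k by rewrite divr_gt0.
have d1 k : d k <= 1.
  rewrite ler_pdivrMr // mul1r (@le_trans _ _ 1) //; first by rewrite exprn_ile1 //; lra.
  by have := M1; lra.
have linid : linear_on V idfun by [].
have [v [x [y' [r [vP xP dP [r_lt r0 sx _]]]]]] :=
  block_sequences basis_e projM B infV linid VB VB d0 (ltr0n _ 2).
have nx k : 1 <= nrm (x k).
  have [_ vk] := vP k; have [/ltW dk _] := dP k.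
  have := nrm_add S (v k - x k) (x k); rewrite subrK vk; have := d1 k; lra.
have x0 k : exists i, cf i (x k) != 0.
  apply: contrapT => h; have := nx k.
  suff -> : x k = 0 by rewrite nrm0; lra.
  apply: (cf_ext S basis_e) => i; rewrite (coef0 cfl).
  by apply: contrapT => /eqP ci; apply: h; exists i.
have c_lt k : (cut B (r k) < cut B (r k.+1))%N by rewrite cut_monolt.
exists (@Blocks _ _ cf x (fun k => cut B (r k)) c_lt x0 sx), v; split.
- split => /= [|k|k]; first by rewrite r0.
    by have [] := xP k.
  by exists (r k).
- by move=> k; have [] := vP k.
- move=> n t /=; set z := nrm (lc n t x).
  have : nrm (lc n t x - lc n t v) <= z / 2.
    rewrite /lc -sumrB (le_trans (nrm_sum _ _ _ _)) //.
    apply: le_trans (_ : \sum_(k < n) z / 2 * 2^-1 ^+ k.+1 <= _).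
      apply: ler_sum => k _; rewrite -scalerBr nrmZ nrmB.
      have [/ltW dk _] := dP k.
      have := supported_bound basis_e projM t c_lt sx (ltn_ord k); rewrite -/(lc n t x) -/z => h.
      have tk : nrm (t k) <= 2 * M * z.
        by apply: le_trans h; rewrite ler_peMr ?nrm_ge0.
      apply: le_trans (ler_pM (nrm_ge0 _ _) (nrm_ge0 _ _) tk dk) _.
      rewrite /d le_eqVlt; apply/orP; left; apply/eqP; field.
      by rewrite gt_eqF.
    rewrite -mulr_sumr ler_piMr ?divr_ge0 ?nrm_ge0 //; exact/ltW/sum_half.
  have := nrm_sub S (lc n t x) (lc n t x - lc n t v); rewrite subKr.
  have := nrm_add S (lc n t v) (lc n t x - lc n t v); rewrite addrC subrK -/z.
  have := nrm_ge0 S (lc n t v); have : 0 <= z by exact: nrm_ge0.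
  by move=> *; split; lra.
Qed.

(** The same coefficients are used over [v] as over [w]. Comparability of [w] and [v] concerns all
    combinations, so it passes to combinations of combinations. *)
Lemma comparable_transfer w (v : nat -> X) x :
  (forall n, comparable S n w v) -> (forall k, fspan w (x k)) ->
  exists x' : nat -> X, (forall k, fspan v (x' k)) /\ forall n, comparable S n x x'.
Proof.
move=> cmp wx.
have /choice[c hc] : forall k, exists c : nat * (nat -> K), x k = lc c.1 c.2 w.
  by move=> k; have [n [a ->]] := wx k; exists (n, a).
exists (fun k => lc (c k).1 (c k).2 v); split; first by move=> k; exact: lc_fspan.
move=> n t; pose N := (\sum_(k < n) (c k).1)%N.
pose c' k j := if (j < (c k).1)%N then (c k).2 j else 0.
have cN k : (k < n)%N -> ((c k).1 <= N)%N.
  by move=> kn; rewrite /N (bigD1 (Ordinal kn)) //= leq_addr.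
have E (s z : nat -> X) : (forall k, (k < n)%N -> s k = lc (c k).1 (c k).2 z) ->
    lc n t s = lc N (fun j => \sum_(k < n) t k * c' k j) z.
  move=> hs; rewrite /lc; under [RHS]eq_bigr => j _ do rewrite scaler_suml.
  rewrite exchange_big; apply: eq_bigr => k _ /=.
  rewrite hs // (lc_pad _ _ (cN k (ltn_ord k))) /lc scaler_sumr.
  by apply: eq_bigr => j _; rewrite scalerA.
by rewrite (E x w) // (E _ v) //; exact: cmp.
Qed.

Lemma pairs_quasi_minimal (C : R) Y : 0 <= C -> cut Y 0 = 0%N ->
  (forall B, sub B Y -> has_pair S C B) ->
  exists Q : set X, inf_dim_subspace Q /\ quasi_minimal Q.
Proof.
move=> C0 Y0 hY.
have [grid hgrid] := near_grid basis_e M1 projM (C + C).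
set C1 := 2 * C + 1; have C10 : 0 <= C1 by rewrite addr_ge0 ?mulr_ge0.
have [Z sZ stZ] := stabilize cfl grid (near S e) (good S e C1) Y.
have Z0 : cut Z 0 = 0%N by case: sZ => ->.
(* The empty word is live since every refinement of [Y] contains a pair, which codes to a good
   run. *)
have lvZ : live grid (near S e) (good S e C1) [::] Z.
  move=> B sB; apply; have B0 : cut B 0 = 0%N by case: sB => ->.
  have [a ra ga] := has_pair_run basis_e C0 B0 (hY B (sub_trans sB sZ)) hgrid.
  by exists a; rewrite B0.
exists (closed_span Z); split; first exact: blocks_inf_dim.
move=> [V [W [[infV VZ] [infW WZ]]]]; apply.
have [U [v [sU Vv cv]]] := near_blocks infV VZ Z0.
have [U' [w [sU' Ww cw]]] := near_blocks infW WZ Z0.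
have gf : forall a, good S e C1 a -> forall l, exists2 i, (l <= i)%N & (a i).2.
  exact: good_flags.
have [a [m [x [y [m0 m_lt fl seg ex]]]]] := strategy cfl gf stZ Z0 lvZ sU sU'.
(* Closedness of goodness: below [m n] the word agrees with a good word, and the flags force the
   same endpoints there, hence the same first [n] pairs. *)
have eqv n : equivalent S C1 3 n (side_sum e false a m) (side_sum e true a m).
  have [a' [m' [m0' m_lt' fl' eqv']] aa'] := ex n.
  have mm : forall k, (k <= n)%N -> m' k = m k.
    apply: steps_eq => // i im; have := fl i; have := fl' i; rewrite aa' //.
    by move=> h1 h2; split=> [/h2/h1|/h1/h2].
  have ss b k : (k < n)%N -> side_sum e b a' m' k = side_sum e b a m k.
    move=> kn; rewrite /side_sum !mm //; last exact: ltnW.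
    have h i : (m k <= i < m k.+1)%N -> a' i = a i.
      move=> /andP[_ ik]; apply: aa'; apply: leq_trans ik _.
      by rewrite steps_mono.
    rewrite big_nat_cond [RHS]big_nat_cond; apply: eq_big => [i|i /andP[ik _]].
      by case: (boolP (m k <= i < m k.+1)%N) => //= /h ->.
    by rewrite h.
  by apply: equivalent_eq (eqv' n) => k; exact: ss.
have sx : supported e m x.
  by move=> k i /negPf ik; have [_ _ /(_ i)] := seg k; rewrite ik => -[].
have sy : supported e m y.
  by move=> k i /negPf ik; have [_ _ /(_ i)] := seg k; rewrite ik => -[].
set C2 := 2 * C1 + 1.
have C20 : 0 <= C2 by rewrite addr_ge0 ?mulr_ge0.
have eqv2 n : equivalent S C2 2 n x y.
  have -> : 2 = 3 - 1 :> R by lra.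
  apply: equivalent_close (eqv n) => //; apply/closeC/close_side_sum => // k i ik.
    have [_ _ /(_ i)] := seg k; rewrite ik eqbF_neg.
    by case: (a i).1.2 => -[].
  have [_ _ /(_ i)] := seg k; rewrite ik eqb_id.
  by case: (a i).1.2 => -[].
have [x' [vx' cx']] := comparable_transfer cv (fun k => let: And3 h _ _ := seg k in h).
have [y' [wy' cy']] := comparable_transfer cw (fun k => let: And3 _ h _ := seg k in h).
(* Halving the lower bound 2 leaves exactly the value 1 needed for infinite dimension and for the
   isomorphism. *)
have eqv3 n : equivalent S (4 * C2) 1 n x' y'.
  have := equivalent_comparable C20 (cx' n) (cy' n) (eqv2 n).
  by rewrite divff.
have inV z : fspan v z -> V z.
  by move=> /(fspan_closed S); apply: (closed_span_sub S) => //; case: infV.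
have inW z : fspan w z -> W z.
  by move=> /(fspan_closed S); apply: (closed_span_sub S) => //; case: infW.
exists (closed_span x'), (closed_span y'); split.
- by apply: (bounded_below_inf_dim (S := S)) => n; have [] := eqv3 n.
- by apply: (closed_span_sub S); [case: infV|move=> k; exact: inV].
- exact: (closed_span_subspace S).
- by apply: (closed_span_sub S); [case: infW|move=> k; exact: inW].
- by apply: (equivalent_isomorphic (S := S) (C := 4 * C2)) => //; rewrite mulr_ge0.
Qed.

End CaseA.

(** * A subspace that is tight by support *)

Lemma bounded_on (R : realType) (K : numFieldType) (S : real_scalars R K)
    (X : completeNormedModType K) (V : set X) (T : X -> X) :
  closed_subspace V -> linear_on V T -> {within V, continuous T} ->
  exists2 C : R, 0 <= C & forall u, V u -> nrm S (T u) <= C * nrm S u.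
Proof.
move=> /subspace_lin[V0 Vlin] linT /(within_nrmP S)/(_ 0 V0 1 ltr01)[d d0 hd].
have T0 : T 0 = 0 by have := linT (-1) 0 0 V0 V0; rewrite scaler0 addr0 scaleN1r addNr.
exists (2 / d); first by rewrite divr_ge0 // ltW.
move=> u Vu; have [->|u0] := eqVneq u 0; first by rewrite T0 nrm0 mulr0.
have nu : 0 < nrm S u by rewrite nrm_gt0.
pose c := d / (2 * nrm S u); have c0 : 0 < c by rewrite divr_gt0 // mulr_gt0.
have := hd (S c *: u); rewrite T0 !sub0r !nrmN.
have -> : T (S c *: u) = S c *: T u by rewrite -[S c *: u]addr0 linT // T0 addr0.
rewrite !nrmZ nrm_rsc ?(ltW c0) // -[S c *: u]addr0 => /(_ (Vlin _ _ _ Vu V0)).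
have -> : c * nrm S u = d / 2 by rewrite /c; field; rewrite gt_eqF.
have d2 : d / 2 < d by lra.
move=> /(_ d2) h; have -> : 2 / d * nrm S u = c^-1 by rewrite /c invf_div; field; rewrite gt_eqF.
by rewrite -[c^-1]mulr1 ler_pdivlMl // ltW.
Qed.

Section CaseB.
Context {R : realType} {K : numFieldType} (S : real_scalars R K).
Context {X : completeNormedModType K} (e : nat -> X) (basis_e : schauder_basis e).
Context (M : R) (M1 : 1 <= M).
Local Notation nrm := (nrm S).
Local Notation cf := (cf e).
Local Notation proj := (basis_proj e).
Hypothesis projM : forall n u, nrm (proj n u) <= M * nrm u.
Implicit Types (u v : X) (x y w : nat -> X) (B U Y Z : blocks cf).

Let cfl := cf_lin S basis_e.

Let M0 : 0 < M. Proof. exact: lt_le_trans M1. Qed.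

Lemma basis_blocks : exists2 B : blocks cf, (B : nat -> X) = e & cut B 0 = 0%N.
Proof.
have h0 n : exists i, cf i (e n) != 0.
  by exists n; rewrite (cf_e S basis_e) eqxx oner_eq0.
have hs n i : ~~ (n <= i < n.+1)%N -> cf i (e n) = 0.
  by rewrite ltnS -eqn_leq (cf_e S basis_e) eq_sym => /negPf ->.
by exists (@Blocks _ _ cf e id ltnSn h0 hs).
Qed.

(** Each later cut is the least coordinate in the support of its vector, and the first cut is 0;
    [supp_lt] bounds each support by the next minimum. *)
Lemma block_basis_blocks x : block_basis e x ->
  exists2 B : blocks cf, (B : nat -> X) = x & cut B 0 = 0%N.
Proof.
move=> [x0 xlt].
have nz n : exists i, cf i (x n) != 0.
  apply: contrapT => h; move/negP: (x0 n); apply; apply/eqP.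
  apply: (cf_ext S basis_e) => i; rewrite (coef0 cfl).
  by apply: contrapT => /eqP ci; apply: h; exists i.
pose mn n := ex_minn (nz n).
have mnP n : cf (mn n) (x n) != 0 by rewrite /mn; case: ex_minnP.
have mnle n i : cf i (x n) != 0 -> (mn n <= i)%N.
  by rewrite /mn; case: ex_minnP => j _; exact.
pose c n := if n is n'.+1 then mn n else 0%N.
have lt_mn n i : cf i (x n) != 0 -> (i < mn n.+1)%N.
  by move=> ci; exact: (xlt n i (mn n.+1) ci (mnP _)).
have c_lt n : (c n < c n.+1)%N.
  by case: n => [|n] /=; [exact: leq_ltn_trans (lt_mn 0%N _ (mnP 0%N))|exact: lt_mn].
have sp n i : ~~ (c n <= i < c n.+1)%N -> cf i (x n) = 0.
  move=> h; apply/eqP; apply: contraNT h => ci; rewrite [X in _ && X]lt_mn // andbT.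
  by case: n ci => // n; exact: mnle.
by exists (@Blocks _ _ cf x c c_lt nz sp).
Qed.

Lemma blocks_block_basis B : block_basis e B.
Proof.
split=> n.
  have [i _ ci] := vec_pivot B n; apply: contraNneq ci => ->.
  by rewrite (coef0 cfl).
have inside m i : cf i (B m) != 0 -> (cut B m <= i < cut B m.+1)%N.
  by move=> ci; apply: contraNT ci => /vec_supp ->.
move=> i j /inside/andP[_ h1] /inside/andP[h2 _].
exact: leq_trans h1 h2.
Qed.

Lemma has_pair_sub (C : R) B B' : sub B' B -> has_pair S C B' -> has_pair S C B.
Proof.
move=> [_ h1 /choice[f hf]] [x [y [r [r_lt [sx sy] sp disj eqv]]]].
exists x, y, (f \o r); split => //.
- by move=> k /=; rewrite -(cut_monolt B) -!hf cut_monolt.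
- by split => k i; rewrite /= -!hf; [exact: sx|exact: sy].
- by move=> k; have [p1 p2] := sp k; split; exact: fspan_trans h1 _.
Qed.

(** Dropping the first [d] pairs suffices: since [r k >= k], the remaining ones live on blocks of
    [B'] of index at least [d], and equivalence survives padding the coefficients by zeros. *)
Lemma has_pair_shift (C : R) B B' d : (forall n, fspan B (B' (n + d)%N)) ->
  (forall n, exists m, cut B' (n + d)%N = cut B m) -> has_pair S C B' -> has_pair S C B.
Proof.
move=> h1 /choice[f hf] [x [y [r [r_lt [sx sy] sp disj [eqv xC yC]]]]].
have r_ge k : (k <= r k)%N by elim: k => // k ih; exact: leq_ltn_trans ih (r_lt k).
have rd k : (r (k + d) - d + d = r (k + d))%N.
  by rewrite subnK // (leq_trans _ (r_ge _)) // leq_addl.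
have sub_tail' z k : fspan B' (z (k + d)%N) -> supported e (cut B' \o r) z ->
    fspan B (z (k + d)%N).
  move=> zk sz; have : fspan (tail d B') (z (k + d)%N).
    apply: (fspan_tail cfl) => // i id; apply: sz => /=.
    rewrite leqNgt (leq_trans id) // cut_mono.
    by rewrite (leq_trans _ (r_ge _)) // leq_addl.
  by apply: fspan_trans => n; exact: h1.
exists (fun k => x (k + d)%N), (fun k => y (k + d)%N), (fun k => f (r (k + d) - d)%N); split.
- by move=> k /=; rewrite -(cut_monolt B) -!hf !rd cut_monolt.
- by split => k i; rewrite /= -!hf !rd; [exact: sx|exact: sy].
- by move=> k; have [p1 p2] := sp (k + d)%N; split; exact: sub_tail'.
- by move=> k; exact: disj.
- split; [|by move=> k; exact: xC|by move=> k; exact: yC].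
  exact: equivalent_shift.
Qed.

(* The hypothesis is applied after lowering the first cut to 0. *)
Lemma no_pair_dense (C : R) :
  (forall Y, cut Y 0 = 0%N -> exists2 B, sub B Y & ~ has_pair S C B) ->
  forall Y, exists2 B, sub B Y & ~ has_pair S C B.
Proof.
move=> h Y.
pose c n := if n is n'.+1 then cut Y n else 0%N.
have c_lt n : (c n < c n.+1)%N.
  by case: n => [|n]; [exact: leq_ltn_trans (cut_lt Y 0)|exact: cut_lt].
have c_le n : (c n <= cut Y n)%N by case: n.
have sp n i : ~~ (c n <= i < c n.+1)%N -> cf i (Y n) = 0.
  move=> hi; apply: vec_supp; apply: contra hi => /andP[h1 h2].
  by rewrite (leq_trans (c_le n)).
have [B [B0 h1 h2] nB] := h (@Blocks _ _ cf Y c c_lt (vec_neq0 Y) sp) erefl.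
have cutB n : exists m, cut B n.+1 = cut Y m.+1.
  have [[|m] em] := h2 n.+1; last by exists m.
  by have := cut_lt B n; rewrite em.
pose c' n := if n is n'.+1 then cut B n else cut Y 0.
have c'_lt n : (c' n < c' n.+1)%N.
  case: n => [|n]; last exact: cut_lt.
  by have [m em] := cutB 0%N; rewrite /= em cut_monolt.
have sp' n i : ~~ (c' n <= i < c' n.+1)%N -> cf i (B n) = 0.
  case: n => [|n]; last exact: vec_supp.
  rewrite /= negb_and -ltnNge => /orP[i0|iB].
    have h10 : fspan Y (B 0%N) by exact: h1.
    exact: (coef_fspan0 cfl h10).
  by apply: vec_supp; rewrite negb_and iB orbT.
exists (@Blocks _ _ cf B c' c'_lt (vec_neq0 B) sp').
  split=> //= -[|n]; first by exists 0%N.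
  by have [m em] := cutB n; exists m.+1.
move=> hp; apply: nB; apply: (@has_pair_shift _ _ _ 1 _ _ hp) => n /=.
  exact: fspan_gen.
by exists n.+1; rewrite addn1.
Qed.

Lemma tight (W : blocks cf) : (forall n, ~ has_pair S n%:R (tail n W)) ->
  forall V V', block_subspace_of e (closed_span W) V ->
  block_subspace_of e (closed_span W) V' ->
  disjointly_supported e V V' -> totally_incomparable V V'.
Proof.
move=> hW _ _ [v [/block_basis_blocks[Bv <- Bv0] vW ->]] [w [/block_basis_blocks[Bw <- Bw0] wW ->]].
move=> disj [V [V' [infV VB closV' V'B [T [T' [[TV T'V] [TK T'K] linT cT cT']]]]]].
have [V0 Vlin] := subspace_lin (proj1 infV).
have [V'0 V'lin] := subspace_lin closV'.
have linT' : linear_on V' T'.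
  move=> k u u' Vu Vu'; rewrite -{1}(T'K _ (mem_set Vu)) -{1}(T'K _ (mem_set Vu')).
  have h : V (k *: T' u + T' u') by apply: Vlin; exact: T'V.
  rewrite -linT; [|exact: T'V|exact: T'V].
  by rewrite TK //; exact: mem_set.
have [CT CT0 hT] := bounded_on S (proj1 infV) linT cT.
have [CT' CT'0 hT'] := bounded_on S closV' linT' cT'.
pose C := CT + CT' + 1.
have C1 : 1 <= C by rewrite /C; lra.
have upT u : V u -> nrm (T u) <= C * nrm u.
  by move=> Vu; apply: le_trans (hT u Vu) _; rewrite ler_wpM2r ?nrm_ge0 // /C; lra.
have loT u : V u -> nrm u <= C * nrm (T u).
  move=> Vu; rewrite -{1}(TK _ (mem_set Vu)); apply: le_trans (hT' _ (TV _ Vu)) _.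
  by rewrite ler_wpM2r ?nrm_ge0 // /C; lra.
(* Even after dividing by [C] for the isomorphism and losing 1 to truncation, all [x k] and [y k]
   have norm at least [8 * M]. By the block bound [2 * M], combinations with a coefficient of
   modulus 1 then have norm at least 4. *)
pose L := C * (8 * M + 1).
have L0 : 0 < L by rewrite mulr_gt0 //; have := M1; have := C1; lra.
pose d k : R := 2^-1 ^+ k.+1.
have d0 k : 0 < d k by rewrite exprn_gt0.
have d1 k : d k <= 1 by rewrite exprn_ile1 //; lra.
have VB1 u : V u -> closed_span Bv u by exact: VB.
have VB2 u : V u -> closed_span Bw (T u) by move=> /TV; exact: V'B.
have [z [x [y [r [zP xyP dP [r_lt r0 sx sy]]]]]] :=
  block_sequences basis_e projM W infV linT VB1 VB2 d0 L0.
have bvW : forall u, fspan Bv u -> closed_span W u.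
  move=> u /(fspan_closed S); apply: (closed_span_sub S) => //.
  exact: (closed_span_subspace S).
have bwW : forall u, fspan Bw u -> closed_span W u.
  move=> u /(fspan_closed S); apply: (closed_span_sub S) => //.
  exact: (closed_span_subspace S).
have finW s k : supported e (cut W \o r) s -> closed_span W (s k) -> fspan W (s k).
  move=> ss Ws; apply: (closed_span_finite basis_e projM Ws (n := cut W (r k.+1))).
  by move=> i ki; apply: ss; rewrite negb_and -leqNgt ki orbT.
have closeP s s' n : (forall k, nrm (s k - s' k) < d k) -> close S n s s'.
  move=> h t st; rewrite /lc -sumrB (le_trans (nrm_sum _ _ _ _)) //.
  apply: le_trans (ltW (sum_half n)); apply: ler_sum => k _.
  rewrite -scalerBr nrmZ; apply: le_trans (ltW (h k)).
  by rewrite ler_piMl ?nrm_ge0.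
have cx n : close S n z x by apply: closeP => k; have [] := dP k.
have cy n : close S n (T \o z) y by apply: closeP => k; have [] := dP k.
have lcV n t : V (lc n t z) /\ T (lc n t z) = lc n t (T \o z).
  have T0 : T 0 = 0 by have := linT (-1) 0 0 V0 V0; rewrite scaler0 addr0 scaleN1r addNr.
  rewrite /lc; elim/big_rec2: _ => [|k a b _ [Va <-]] //.
  by have [Vz _] := zP k; split; [exact: Vlin|rewrite linT].
have rc_lt k : ((cut W \o r) k < (cut W \o r) k.+1)%N by rewrite /= cut_monolt.
have low s n : supported e (cut W \o r) s -> (forall k, 8 * M <= nrm (s k)) ->
    bounded_below S 4 n s.
  move=> ss hs t st k kn tk; have := supported_bound basis_e projM t rc_lt ss kn.
  by rewrite -/(lc n t s) tk mul1r; have := hs k; have := M0; nra.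
have nz k : L - 1 <= nrm (x k) <= L + 1.
  have [_ ez] := zP k; have [h _] := dP k; have := d1 k.
  have := nrm_add S (z k - x k) (x k); rewrite subrK ez.
  have := nrm_sub S (z k) (z k - x k); rewrite subKr ez.
  by move=> *; apply/andP; split; lra.
have nTz k : 8 * M + 1 <= nrm (T (z k)) <= C * L.
  have [Vz ez] := zP k; have := upT _ Vz; have := loT _ Vz; rewrite ez => h1 h2.
  rewrite h2 andbT -(ler_pM2l (_ : 0 < C)) //; lra.
have ny k : 8 * M <= nrm (y k) <= C * L + 1.
  have [_ h] := dP k; have := d1 k; have /andP[] := nTz k.
  have := nrm_add S (T (z k) - y k) (y k); rewrite subrK.
  have := nrm_sub S (T (z k)) (T (z k) - y k); rewrite subKr.
  by move=> *; apply/andP; split; lra.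
have dom1 n : dominated S C n z (T \o z).
  move=> t st; have [Vl <-] := lcV n t; apply: le_trans (loT _ Vl) _.
  by rewrite ler_wpM2l ?lerDr //; lra.
have dom2 n : dominated S C n (T \o z) z.
  move=> t st; have [Vl <-] := lcV n t; apply: le_trans (upT _ Vl) _.
  by rewrite ler_wpM2l ?lerDr //; lra.
have C0 : 0 <= C by lra.
have LM : 8 * M + 1 <= L by rewrite ler_peMl //; have := M1; lra.
(* [N] exceeds the equivalence constant [2 * C + 1] and both norm bounds, [L + 1] for the [x k] and
   [C * L + 1] for the [y k]. *)
pose N := (Num.truncn (2 * C + 1 + (L + 1) + (C * L + 1))).+1.
have CL : 0 <= C * L by rewrite mulr_ge0 // ltW.
have hN : 2 * C + 1 + (L + 1) + (C * L + 1) < N%:R by exact: truncnS_gt.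
(* The pair is only known to lie in [W]; after its first [N] terms are dropped it lies in the tail
   that excludes constant [N]. *)
apply: (hW N); apply: (@has_pair_shift _ _ W N).
- move=> n; exact: (fspan_gen (tail N W) n).
- by move=> n; exists n.
exists x, y, r; split => //.
- move=> k; have [p1 p2] := xyP k.
  by split; apply: finW => //; [exact: bvW|exact: bwW].
- move=> k i; apply: contrapT => /not_orP[/eqP c1 /eqP c2].
  have [p1 p2] := xyP k.
  have : (supp e (x k) `&` supp e (y k)) i by [].
  by rewrite disj //; exact: (fspan_closed S).
split.
- move=> n; apply: (@equivalentW _ _ S _ (2 * C + 1)); first by lra.
  split.
  + exact: dominated_close (cx n) (cy n) (dom1 n).
  + exact: dominated_close (cy n) (cx n) (dom2 n).
  + by apply: low => // k; have /andP[] := nz k; lra.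
  + by apply: low => // k; have /andP[] := ny k; lra.
- by move=> k; have /andP[] := nz k; lra.
- by move=> k; have /andP[] := ny k; lra.
Qed.

Lemma tight_subspace :
  (forall C Y, 0 <= C -> cut Y 0 = 0%N -> exists2 B, sub B Y & ~ has_pair S C B) ->
  exists W : blocks cf, forall n, ~ has_pair S n%:R (tail n W).
Proof.
move=> h; have [B0 _ _] := basis_blocks.
have [||||W _ hW] := @fusion _ _ cf (fun=> True)
    (fun n B => ~ has_pair S n%:R B) _ _ _ _ B0 I => //.
- by move=> n B B' sB nB hB; apply: nB; exact: has_pair_sub hB.
- move=> n B _; apply: no_pair_dense => Y Y0; exact: h.
- by exists W.
Qed.

End CaseB.

Lemma quasi_minimal_or_tight (R : realType) (K : numFieldType) (S : real_scalars R K)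
    (X : completeNormedModType K) (e : nat -> X) :
  schauder_basis e ->
  (exists Q : set X, inf_dim_subspace Q /\ quasi_minimal Q) \/
  (exists2 Y : set X, block_subspace e Y &
    forall V W : set X, block_subspace_of e Y V -> block_subspace_of e Y W ->
      disjointly_supported e V W -> totally_incomparable V W).
Proof.
move=> he; have [M M1 projM] := proj_bounded S he.
have [[C [Y [C0 Y0 hY]]]|hn] := pselect (exists C (Y : blocks (cf e)),
  [/\ 0 <= C, cut Y 0 = 0%N & forall B, sub B Y -> has_pair S C B]).
  by left; exact: (pairs_quasi_minimal he M1 projM C0 Y0 hY).
right; have [|W hW] := tight_subspace (S := S) he.
  move=> C Y C0 Y0; apply: contrapT => h; apply: hn; exists C, Y; split => // B sB.
  by apply: contrapT => nB; apply: h; exists B.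
exists (closed_span W); last first.
  by move=> V V'; exact: (tight he M1 projM hW).
exists W; split; [exact: (blocks_block_basis S he)|by []|by []].
Qed.

Lemma isomorphic_not_incomparable (K : numFieldType) (X : completeNormedModType K)
    (V W : set X) :
  inf_dim_subspace V -> closed_subspace W -> totally_incomparable V W -> ~ isomorphic V W.
Proof. by move=> infV clW ti iso; apply: ti; exists V, W; split. Qed.

Theorem theorem7p2 (R : realType) (K : numFieldType)
  (hK : K = R :> numFieldType \/ K = R[i] :> numFieldType)
  (X : completeNormedModType K) (e : nat -> X)
  (he : unconditional_basis e) :
  (exists Q : set X, inf_dim_subspace Q /\ quasi_minimal Q) \/
  (exists Y : set X,
    [/\ block_subspace e Y,
        forall V W : set X,
          block_subspace_of e Y V -> block_subspace_of e Y W ->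
          disjointly_supported e V W -> ~ isomorphic V W &
        forall V W : set X,
          block_subspace_of e Y V -> block_subspace_of e Y W ->
          disjointly_supported e V W -> totally_incomparable V W]).
Proof.
have [S] : exists S : real_scalars R K, True.
  case: hK => E; move: X e he; rewrite E => *.
    by exists (real_scalars_real R).
  by exists (real_scalars_complex R).
have [he1 _] := he; have [M _ projM] := proj_bounded S he1.
have [[Q hQ]|[Y bY tY]] := quasi_minimal_or_tight S he1; first by left; exists Q.
right; exists Y; split => // V W bV bW disj.
(* An isomorphism of [V] and [W] would contradict total incomparability with [V] and [W] themselves
   as the two subspaces, [V] being infinite-dimensional. *)
apply: isomorphic_not_incomparable (tY V W bV bW disj).
  have [v [/(block_basis_blocks S he1)[B <- _] _ ->]] := bV.
  exact: (blocks_inf_dim he1 projM B).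
have [w [_ _ ->]] := bW; exact: (closed_span_subspace S).
Qed.
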